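(* An infinite bitstring $X$ is Schnorr random if and only if for every computable measure machine $C$ and every $d$, there is $n_0$ such that $K_C(X\upharpoonright n)>n+d$ for all $n\ge n_0$.
   Context: A computable measure machine is a prefix-free Turing machine $C$ whose domain $\operatorname{dom}(C)\subseteq\{0,1\}^*$ has computable Lebesgue measure $\sum_{\pi\in\operatorname{dom}(C)}2^{-|\pi|}$. For such $C$ and a finite string $\sigma$, $K_C(\sigma)=\inf\{|\pi|:C(\pi)=\sigma\}$, with $\inf\emptyset=\infty$. $X\upharpoonright n$ denotes the first $n$ bits of $X$. $X$ is Schnorr random (in the usual classical sense) if $X$ passes every Schnorr test, where a Schnorr test is a computable sequence $(S^m)_m$ of clopen subsets of Cantor space, each given by a finite set of strings, such that $\sum_m\mu(S^m)$ is a computable real ($\mu$ the uniform Lebesgue measure), and $X$ passes it if $X\in S^m$ for only finitely many $m$. *)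

(* Defs.v *)
From HB Require Import structures.
From mathcomp Require Import all_boot all_order all_algebra.
From mathcomp Require Import all_classical all_reals all_analysis.
Set Implicit Arguments. Unset Strict Implicit. Unset Printing Implicit Defensive.
Import Order.TTheory GRing.Theory Num.Theory.
Import numFieldNormedType.Exports.
Local Open Scope classical_set_scope.
Local Open Scope ring_scope.

Inductive rcode : Type :=
| CZero : rcode
| CSucc : rcode
| CProj : nat -> rcode
| CComp : rcode -> list rcode -> rcode
| CPrec : rcode -> rcode -> rcode
| CMu   : rcode -> rcode.

Inductive eval : rcode -> seq nat -> nat -> Prop :=
| evZero v : eval CZero v 0
| evSucc v : eval CSucc v (head 0%N v).+1
| evProj i v : eval (CProj i) v (nth 0%N v i)
| evComp f gs v ws y : evals gs v ws -> eval f ws y -> eval (CComp f gs) v y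
| evPrec0 f g v y : eval f v y -> eval (CPrec f g) (0%N :: v) y
| evPrecS f g n v r y : eval (CPrec f g) (n :: v) r ->
    eval g (n :: r :: v) y -> eval (CPrec f g) (n.+1 :: v) y
| evMu f v n : eval f (n :: v) 0%N ->
    (forall m, (m < n)%N -> exists k, eval f (m :: v) k.+1) ->
    eval (CMu f) v n
with evals : seq rcode -> seq nat -> seq nat -> Prop :=
| evsNil v : evals [::] v [::]
| evsCons g gs v w ws : eval g v w -> evals gs v ws -> evals (g :: gs) v (w :: ws).

(* Bijective coding of binary strings by natural numbers:
   s |-> (the number with binary expansion 1s) - 1. *)
Definition enc (s : seq bool) : nat :=
  (foldl (fun n (b : bool) => n.*2 + b) 1 s).-1.

Definition zdec (k : nat) : int :=
  if odd k then - ((k.+1)./2)%:Z else (k./2)%:Z.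

Definition computable_real (R : realType) (r : R) : Prop :=
  exists e : rcode, forall n : nat, exists k : nat,
    eval e [:: n] k /\ `|(zdec k)%:~R / 2%:R ^+ n - r| <= (2%:R ^+ n)^-1.

Definition machine_out (e : rcode) (pi sigma : seq bool) : Prop :=
  eval e [:: enc pi] (enc sigma).

Definition in_dom (e : rcode) (pi : seq bool) : Prop :=
  exists sigma, machine_out e pi sigma.

Definition prefix_free_machine (e : rcode) : Prop :=
  forall pi pi', in_dom e pi -> in_dom e pi' -> prefix pi pi' -> pi = pi'.

(* Lebesgue measure of dom(C) = sum_{pi in dom C} 2^-|pi|, organised by length:
   the value is the limit of the partial sums over lengths < N. *)
Definition dom_weight_len (R : realType) (e : rcode) (L : nat) : R :=
  \sum_(t : L.-tuple bool | `[< in_dom e t >]) (2%:R ^+ L)^-1.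

Definition dom_measure_is (R : realType) (e : rcode) (r : R) : Prop :=
  (fun N => \sum_(0 <= L < N) dom_weight_len R e L) @ \oo --> r.

Definition cm_machine (R : realType) (e : rcode) : Prop :=
  prefix_free_machine e /\
  exists r : R, dom_measure_is e r /\ computable_real r.

(* K_C(sigma) = inf { |pi| : C(pi) = sigma }, with inf of the empty set = +oo. *)
Definition KC (R : realType) (e : rcode) (sigma : seq bool) : \bar R :=
  ereal_inf [set ((size pi)%:R)%:E | pi in [set pi | machine_out e pi sigma]].

Definition restr (X : nat -> bool) (n : nat) : seq bool := mkseq X n.

(* Clopen set given by a finite list of strings: union of the cylinders [sigma]. *)
Definition in_clopen (S : seq (seq bool)) (X : nat -> bool) : bool :=
  has (fun sigma => sigma == restr X (size sigma)) S.

(* Uniform (Lebesgue) measure of that clopen set: proportion of strings of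
   length L = max |sigma| that extend some sigma in S. *)
Definition mu_clopen (R : realType) (S : seq (seq bool)) : R :=
  let L := \max_(sigma <- S) size sigma in
  #|[set t : L.-tuple bool | has (fun sigma => prefix sigma t) S]|%:R / 2%:R ^+ L.

(* The sequence S is computable (via strong indices): a total rcode e with
   e(m,0) = number of strings of S m and e(m,i+1) = (rcode of) its i-th string. *)
Definition computable_clopen_seq (S : nat -> seq (seq bool)) : Prop :=
  exists e : rcode, forall m : nat,
    eval e [:: m; 0%N] (size (S m)) /\
    forall i, (i < size (S m))%N -> eval e [:: m; i.+1] (enc (nth [::] (S m) i)).

Definition schnorr_test (R : realType) (S : nat -> seq (seq bool)) : Prop :=
  computable_clopen_seq S /\
  exists r : R, computable_real r /\
    (fun N => \sum_(0 <= m < N) mu_clopen R (S m)) @ \oo --> r.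

Definition passes (S : nat -> seq (seq bool)) (X : nat -> bool) : Prop :=
  exists m0, forall m, (m0 <= m)%N -> ~~ in_clopen (S m) X.

Definition schnorr_random (R : realType) (X : nat -> bool) : Prop :=
  forall S, schnorr_test R S -> passes S X.

(* Main.v *)
(** If [X] is Schnorr random and [C] is a computable measure machine, enumerate
    the domain of [C] by step-bounded evaluation and let the [m]-th test set be
    the cylinder of [C(pi)], where [pi] is the [m]-th enumerated input, provided
    [|pi| <= |C(pi)| + d].  Its measure is at most [2^d 2^-|pi|], so the computable
    sum of the weights [2^-|pi|] controls the tails of the measures of the test
    sets, whose sum is therefore computable.  Since [X] lies in only finitely many
    of them, only finitely many prefixes of [X] have a description of length at
    most [n + d].

    Conversely, let [S] be a Schnorr test of total measure [r <= 2^c].  Choose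
    a computable strictly increasing [L] such that [L m] bounds the lengths of
    the strings of [S m], and describe each string of length [L m] in the clopen
    set [S m] by a word of length [L m + c].  The lengths increase with [m], so
    consecutive dyadic intervals yield a prefix-free set of words, of measure
    [2^-c r].  If [X] is in [S m], then the prefix of [X] of length [L m] has
    complexity at most [L m + c]. *)
Require Import Defs.
From mathcomp Require Import all_boot all_order all_algebra.
From mathcomp Require Import all_classical all_reals all_analysis.
From mathcomp Require Import zify ring lra.
(* Imported again because [eval] is shadowed by a name of all_analysis. *)
Require Import Defs.
Set Implicit Arguments. Unset Strict Implicit. Unset Printing Implicit Defensive.

(** * Total recursive functions *)

(** Only lists of length [n] are constrained, so [f] may be written with total list operations whose
    defaults elsewhere are arbitrary. *)
Definition recfun (n : nat) (f : seq nat -> nat) : Prop :=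
  exists e : rcode, forall v, size v = n -> eval e v (f v).

Lemma recfun_ext n f g : (forall v, size v = n -> f v = g v) -> recfun n f -> recfun n g.
Proof. by move=> fg [e He]; exists e => v sv; rewrite -fg //; exact: He. Qed.

Lemma recfun_nth n i : recfun n (fun v => nth 0 v i).
Proof. exists (CProj i) => v _; exact: evProj. Qed.

Lemma recfun_var n (g : seq nat -> seq nat) i k :
  (forall w, nth 0 (g w) i = nth 0 w k) -> recfun n (fun w => nth 0 (g w) i).
Proof. by move=> E; apply: (@recfun_ext _ (fun w => nth 0 w k)) (recfun_nth _ _). Qed.

Lemma recfun_comp n (gs : seq (seq nat -> nat)) f :
  recfun (size gs) f -> (forall g, List.In g gs -> recfun n g) ->
  recfun n (fun v => f [seq g v | g <- gs]).
Proof.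
move=> [e He] Hgs.
suff [es Hes] : exists es, forall v, size v = n -> evals es v [seq g v | g <- gs].
  exists (CComp e es) => v sv; apply: evComp (Hes v sv) _.
  by apply: He; rewrite size_map.
elim: gs Hgs {He} => [|g gs IH] Hgs; first by exists [::] => v _; exact: evsNil.
have [es Hes] := IH (fun h hin => Hgs h (or_intror hin)).
have [a Ha] := Hgs g (or_introl erefl).
by exists (a :: es) => v sv; apply: evsCons; [exact: Ha | exact: Hes].
Qed.

(** The list [a w] is rebuilt from its [k] coordinates, which reduces a list-valued substitution
    such as [i :: behead w] to [recfun_comp]. *)
Lemma recfun_subst n k (a : seq nat -> seq nat) f : recfun k f ->
  (forall w, size w = n -> size (a w) = k) ->
  (forall i, recfun n (fun w => nth 0 (a w) i)) -> recfun n (fun w => f (a w)).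
Proof.
move=> Hf sa Ha.
apply: (@recfun_ext _ (fun w => f [seq g w | g <- [seq (fun w => nth 0 (a w) i) | i <- iota 0 k]])).
  by move=> w sw; congr f; rewrite -map_comp -[RHS](mkseq_nth 0) sa //; exact: eq_map.
apply: recfun_comp; rewrite ?size_map ?size_iota // => g.
by elim: (iota 0 k) => //= i s IH [<-|/IH //]; exact: Ha.
Qed.

Definition recfun1 (f : nat -> nat) := recfun 1 (fun v => f (nth 0 v 0)).
Definition recfun2 (f : nat -> nat -> nat) := recfun 2 (fun v => f (nth 0 v 0) (nth 0 v 1)).

Lemma recfun_c1 n f g : recfun1 f -> recfun n g -> recfun n (fun v => f (g v)).
Proof.
move=> Hf Hg; apply: (@recfun_comp n [:: g] (fun v => f (nth 0 v 0))) => //.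
by move=> h [<-|[]].
Qed.

Lemma recfun_c2 n f g h : recfun2 f -> recfun n g -> recfun n h -> recfun n (fun v => f (g v) (h v)).
Proof.
move=> Hf Hg Hh; apply: (@recfun_comp n [:: g; h] (fun v => f (nth 0 v 0) (nth 0 v 1))) => //.
by move=> k [<-|[<-|[]]].
Qed.

Lemma recfun_succ n f : recfun n f -> recfun n (fun v => (f v).+1).
Proof.
apply: (@recfun_c1 n succn); exists CSucc => v _; rewrite nth0; exact: evSucc.
Qed.

Lemma recfun_const n c : recfun n (fun=> c).
Proof. by elim: c => [|c IH]; [exists CZero => v _; exact: evZero | exact: recfun_succ]. Qed.

Lemma recfun_behead n f : recfun n f -> recfun n.+1 (fun w => f (behead w)).
Proof.
move=> Hf; apply: (recfun_subst Hf) => [w|i]; first by rewrite size_behead => ->.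
by apply: recfun_ext (recfun_nth _ i.+1) => w _; rewrite nth_behead.
Qed.

Lemma recfun_rec n a f g : recfun n a -> recfun n f ->
  recfun n.+2 (fun w => g (nth 0 w 0) (nth 0 w 1) (behead (behead w))) ->
  recfun n (fun v => nat_rect (fun=> nat) (f v) (fun i r => g i r v) (a v)).
Proof.
move=> Ha [ef Hf] [eg Hg].
have H : recfun n.+1 (fun w => nat_rect (fun=> nat) (f (behead w))
          (fun i r => g i r (behead w)) (nth 0 w 0)).
  exists (CPrec ef eg) => -[//|x v] /= [sv].
  elim: x => [|x IH] /=; first by apply: evPrec0; exact: Hf.
  apply: evPrecS IH _; set r := nat_rect _ _ _ _.
  by apply: (Hg (x :: r :: v)); rewrite /= sv.
apply: (recfun_subst (a := fun v => a v :: v) H) => [w /= ->|[|i]] //.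
exact: recfun_nth.
Qed.

Ltac recfun_proj := eapply recfun_var; let w := fresh in
  intro w; rewrite ?nth_behead; reflexivity.

Lemma recfun_add n f g : recfun n f -> recfun n g -> recfun n (fun v => f v + g v).
Proof.
move=> Hf Hg.
apply: (@recfun_ext _ (fun v => nat_rect (fun=> nat) (f v) (fun _ r => r.+1) (g v))).
  by move=> v _; elim: (g v) => [|k /= ->]; rewrite ?addn0 ?addnS.
by apply: (recfun_rec (g := fun _ r _ => r.+1)) => //; apply: recfun_succ; exact: recfun_nth.
Qed.

Lemma recfun_mul n f g : recfun n f -> recfun n g -> recfun n (fun v => f v * g v).
Proof.
move=> Hf Hg.
apply: (@recfun_ext _ (fun v => nat_rect (fun=> nat) 0 (fun _ r => r + f v) (g v))).
  by move=> v _; elim: (g v) => [|k /= ->]; rewrite ?muln0 // mulnS addnC.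
apply: (recfun_rec (f := fun=> 0) (g := fun _ r v => r + f v)) => //; first exact: recfun_const.
apply: recfun_add; first exact: recfun_nth.
by apply: (@recfun_behead _ (fun w => f (behead w))); exact: recfun_behead.
Qed.

Lemma recfun_pred n f : recfun n f -> recfun n (fun v => (f v).-1).
Proof.
move=> Hf.
apply: (@recfun_ext _ (fun v => nat_rect (fun=> nat) 0 (fun i _ => i) (f v))).
  by move=> v _; case: (f v).
apply: (recfun_rec (f := fun=> 0) (g := fun i _ _ => i)) => //; [exact: recfun_const | exact: recfun_nth].
Qed.

Lemma recfun_sub n f g : recfun n f -> recfun n g -> recfun n (fun v => f v - g v).
Proof.
move=> Hf Hg.
apply: (@recfun_ext _ (fun v => nat_rect (fun=> nat) (f v) (fun _ r => r.-1) (g v))).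
  by move=> v _; elim: (g v) => [|k /= ->]; rewrite ?subn0 ?subnS.
by apply: (recfun_rec (g := fun _ r _ => r.-1)) => //; apply: recfun_pred; exact: recfun_nth.
Qed.

Lemma recfun_exp2 n f : recfun n f -> recfun n (fun v => 2 ^ f v).
Proof.
move=> Hf.
apply: (@recfun_ext _ (fun v => nat_rect (fun=> nat) 1 (fun _ r => 2 * r) (f v))).
  by move=> v _; elim: (f v) => [|k /= ->]; rewrite ?expnS.
apply: (recfun_rec (f := fun=> 1) (g := fun _ r _ => 2 * r)) => //; first exact: recfun_const.
by apply: recfun_mul; [exact: recfun_const | exact: recfun_nth].
Qed.

(** Bounded sums are the basic loop: bounded quantifiers, halving, the binary logarithm and the
    cut-off mu-search are all expressed by them. *)
Lemma recfun_sum n b F : recfun n b ->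
  recfun n.+1 (fun w => F (nth 0 w 0) (behead w)) ->
  recfun n (fun v => \sum_(0 <= i < b v) F i v).
Proof.
move=> Hb HF.
apply: (@recfun_ext _ (fun v => nat_rect (fun=> nat) 0 (fun i r => r + F i v) (b v))).
  by move=> v _; elim: (b v) => [|k /= ->]; [rewrite big_geq | rewrite big_nat_recr].
apply: (recfun_rec (f := fun=> 0) (g := fun i r v => r + F i v)) => //; first exact: recfun_const.
apply: recfun_add; first exact: recfun_nth.
apply: (recfun_subst (a := fun w => nth 0 w 0 :: behead (behead w)) HF).
  by move=> [|x [|y v]] //= [->].
by move=> [|i] /=; recfun_proj.
Qed.

(** * Decidable predicates, bounded quantification and minimisation *)

Definition recpred n (P : seq nat -> bool) := recfun n (fun v => nat_of_bool (P v)).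

Lemma recpred_ext n P Q : (forall v, size v = n -> P v = Q v) -> recpred n P -> recpred n Q.
Proof. by move=> PQ; apply: recfun_ext => v sv; rewrite PQ. Qed.

Lemma recpred_neg n P : recpred n P -> recpred n (fun v => ~~ P v).
Proof.
move=> HP; apply: recfun_ext (recfun_sub (recfun_const n 1) HP) => v _ /=.
by case: (P v).
Qed.

Lemma recpred_and n P Q : recpred n P -> recpred n Q -> recpred n (fun v => P v && Q v).
Proof.
move=> HP HQ; apply: recfun_ext (recfun_mul HP HQ) => v _ /=; exact: mulnb.
Qed.

Lemma recpred_leq n f g : recfun n f -> recfun n g -> recpred n (fun v => f v <= g v).
Proof.
move=> Hf Hg; apply: recfun_ext (recfun_sub (recfun_const n 1) (recfun_sub Hf Hg)) => v _ /=.
by rewrite /leq; case: (f v - g v).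
Qed.

Lemma recpred_eq n f g : recfun n f -> recfun n g -> recpred n (fun v => f v == g v).
Proof.
move=> Hf Hg; apply: recpred_ext (recpred_and (recpred_leq Hf Hg) (recpred_leq Hg Hf)) => v _.
by rewrite eqn_leq.
Qed.

Definition bex (b : nat) (P : nat -> bool) : bool := has P (iota 0 b).

Lemma bexP b (P : nat -> bool) : reflect (exists2 i, i < b & P i) (bex b P).
Proof.
apply: (iffP hasP) => [[i]|[i ib Pi]]; rewrite ?mem_iota; exists i => //.
by rewrite mem_iota.
Qed.

Lemma recpred_bex n b P : recfun n b -> recpred n.+1 (fun w => P (nth 0 w 0) (behead w)) ->
  recpred n (fun v => bex (b v) (P ^~ v)).
Proof.
move=> Hb HP.
have H := recfun_sum (F := fun i v => nat_of_bool (P i v)) Hb HP.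
apply: recpred_ext (recpred_leq (recfun_const n 1) H) => v _.
rewrite lt0n sum_nat_seq_eq0 /bex /index_iota subn0 -has_predC.
by apply: eq_has => i /=; rewrite eqb0 negbK.
Qed.

Lemma recfun_if n P f g : recpred n P -> recfun n f -> recfun n g ->
  recfun n (fun v => if P v then f v else g v).
Proof.
move=> HP Hf Hg; apply: recfun_ext (recfun_add (recfun_mul HP Hf) (recfun_mul (recpred_neg HP) Hg)) => v _.
by case: (P v); rewrite /= ?mul1n ?mul0n ?addn0.
Qed.

(** Since a witness always exists, the function giving the least one can be chosen first and then
    shown to be what a mu-search computes. *)
Lemma recfun_min n P : recpred n.+1 (fun w => P (nth 0 w 0) (behead w)) ->
  (forall v, size v = n -> exists x, P x v) ->
  exists2 g, recfun n g & forall v, size v = n -> P (g v) v.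
Proof.
move=> /recpred_neg [e He] ex.
have /choice [g Hg] v : exists x, size v = n ->
    P x v /\ forall y, y < x -> ~~ P y v.
  have [sv|] := pselect (size v = n); last by exists 0.
  have [/= x Px xmin] := ex_minnP (ex v sv); exists x => _; split=> // y.
  by apply: contraTN => /xmin; rewrite -leqNgt.
exists g => [|v sv]; last by case: (Hg v sv).
(* [e] computes the negation of [P]: it is 0 at the least witness and 1 before it, as [evMu]
   demands. *)
exists (CMu e) => v sv; have [Pg gmin] := Hg v sv.
apply: evMu => [|m /gmin nP].
  by have := He (g v :: v); rewrite /= Pg sv; exact.
by exists 0; have := He (m :: v); rewrite /= nP sv; exact.
Qed.

(** * Step-bounded evaluation *)

Fixpoint rcode_nested_ind (P : rcode -> Prop) (H0 : P CZero) (H1 : P CSucc)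
  (H2 : forall i, P (CProj i))
  (H3 : forall f gs, P f -> List.Forall P gs -> P (CComp f gs))
  (H4 : forall f g, P f -> P g -> P (CPrec f g))
  (H5 : forall f, P f -> P (CMu f)) (e : rcode) : P e :=
  let rec := rcode_nested_ind H0 H1 H2 H3 H4 H5 in
  match e with
  | CZero => H0 | CSucc => H1 | CProj i => H2 i
  | CComp f gs => H3 f gs (rec f)
      ((fix all_rec gs := match gs return List.Forall P gs with
        | [::] => List.Forall_nil P
        | g :: gs => List.Forall_cons g (rec g) (all_rec gs) end) gs)
  | CPrec f g => H4 f g (rec f) (rec g)
  | CMu f => H5 f (rec f)
  end.

(* [steps t e v] is [0] if the computation is not seen to halt when all
   mu-searches are cut off at [t], and [y.+1] if it returns [y]. *)
Fixpoint steps (t : nat) (e : rcode) (v : seq nat) : nat :=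
  match e with
  | CZero => 1
  | CSucc => (head 0 v).+2
  | CProj i => (nth 0 v i).+1
  | CComp f gs => let ws := [seq steps t g v | g <- gs] in
      if 0 \in ws then 0 else steps t f [seq w.-1 | w <- ws]
  | CPrec f g => if v is n :: v' then
      nat_rect (fun=> nat) (steps t f v')
        (fun i r => if r == 0 then 0 else steps t g [:: i, r.-1 & v']) n
      else 0
  | CMu f => \sum_(0 <= m < t) if (steps t f (m :: v) == 1) &&
      ~~ bex m (fun i => steps t f (i :: v) <= 1) then m.+1 else 0
  end.

(** Evaluates the sum by which [steps] expresses a mu-search: only the least zero contributes. *)
Lemma sum_at_most_one (t n : nat) (P : nat -> bool) (F : nat -> nat) : n < t ->
  (forall i, i < t -> P i = (i == n)) ->
  \sum_(0 <= i < t) (if P i then F i else 0) = F n.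
Proof.
move=> lt_nt HP; rewrite big_mkord (bigD1 (Ordinal lt_nt)) //= HP // eqxx.
rewrite big1 ?addn0 // => i ne_in; rewrite HP //.
by case: eqP => // E; case/eqP: ne_in; apply: val_inj.
Qed.

Lemma steps_eval t e v y : steps t e v = y.+1 -> eval e v y.
Proof.
elim/rcode_nested_ind: e v y => [||i|f gs IHf IHgs|f g IHf IHg|f IHf] v y /=.
- by case=> <-; exact: evZero.
- by case=> <-; exact: evSucc.
- by case=> <-; exact: evProj.
- case: ifP => // /negbT nz /IHf; apply: evComp.
  elim: IHgs nz => {gs} [|g gs IHg _ IH] /=; first by move=> _; exact: evsNil.
  rewrite inE negb_or => /andP[nz /IH Hgs]; apply: evsCons => //.
  by apply: IHg; rewrite prednK // lt0n eq_sym.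
- case: v => // n v; elim: n y => [|n IH] y /=; first by move/IHf; exact: evPrec0.
  case: eqP => // /eqP nz /IHg; apply: evPrecS; apply: IH.
  by rewrite prednK // lt0n.
- move=> E.
  have /hasP[m] : has (fun m => (steps t f (m :: v) == 1) &&
      ~~ bex m (fun i => steps t f (i :: v) <= 1)) (index_iota 0 t).
    by apply/negPn/negP => /hasPn nH; move: E; rewrite big_seq big1 // => i /nH /= /negbTE ->.
  rewrite mem_index_iota /= => lt_mt /andP[/eqP fm /bexP nf].
  have {}nf i : i < m -> 1 < steps t f (i :: v).
    by move=> im; rewrite ltnNge; apply/negP => H; apply: nf; exists i.
  have Em : \sum_(0 <= m < t) (if (steps t f (m :: v) == 1) &&
      ~~ bex m (fun i => steps t f (i :: v) <= 1) then m.+1 else 0) = m.+1.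
    apply: (@sum_at_most_one t _ _ succn lt_mt) => i _; apply/idP/eqP => [|->].
      case/andP => /eqP fi /bexP ni; apply/eqP; rewrite eqn_leq.
      rewrite leqNgt [X in _ && X]leqNgt; apply/andP; split; apply/negP => im.
        by apply: ni; exists m => //; rewrite fm.
      by have := nf _ im; rewrite fi.
    by rewrite fm eqxx; apply/bexP => -[j /nf]; rewrite ltnNge => /negbTE ->.
  move: E; rewrite Em => -[<-]; apply: evMu => [|i im]; first exact: IHf.
  (* One predecessor undoes the shift made by [steps], the other exhibits the output as a
     successor. *)
  exists (steps t f (i :: v)).-2; apply: IHf; have := nf _ im; lia.
Qed.

Lemma eval_CompP f gs v y : eval (CComp f gs) v y ->
  exists2 ws, evals gs v ws & eval f ws y.
Proof. by move=> H; inversion H; subst; exists ws. Qed.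

Lemma evals_consP g gs v ws : evals (g :: gs) v ws ->
  exists w ws', [/\ ws = w :: ws', eval g v w & evals gs v ws'].
Proof. by move=> H; inversion H; subst; exists w, ws0. Qed.

Lemma eval_Prec0P f g v y : eval (CPrec f g) (0 :: v) y -> eval f v y.
Proof. by move=> H; inversion H; subst. Qed.

Lemma eval_PrecSP f g n v y : eval (CPrec f g) (n.+1 :: v) y ->
  exists2 r, eval (CPrec f g) (n :: v) r & eval g [:: n, r & v] y.
Proof. by move=> H; inversion H; subst; exists r. Qed.

Lemma eval_MuP f v n : eval (CMu f) v n ->
  eval f (n :: v) 0 /\ forall m, m < n -> exists k, eval f (m :: v) k.+1.
Proof. by move=> H; inversion H; subst. Qed.

(** Asking for the value at every large cut-off, and not just at one, lets the bounds of the
    subcomputations be combined by maxima. *)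
Lemma eval_steps e v y : eval e v y ->
  exists t0, forall t, t0 <= t -> steps t e v = y.+1.
Proof.
elim/rcode_nested_ind: e v y => [||i|f gs IHf IHgs|f g IHf IHg|f IHf] v y H.
- by inversion H; exists 0.
- by inversion H; exists 0.
- by inversion H; exists 0.
- have [ws Hgs /IHf[t1 H1]] := eval_CompP H.
  have [t2 H2] : exists t0, forall t, t0 <= t ->
     [seq steps t g v | g <- gs] = [seq w.+1 | w <- ws].
    elim: IHgs ws Hgs {H1 H} => {gs} [|g gs IHg _ IH] ws Hgs.
      by inversion Hgs; exists 0.
    have [w [ws' [-> /IHg[t3 H3] /IH[t4 H4]]]] := evals_consP Hgs.
    exists (maxn t3 t4) => t; rewrite geq_max => /andP[/H3 E3 /H4 E4] /=.
    by rewrite E3 E4.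
  exists (maxn t1 t2) => t; rewrite geq_max => /andP[/H1 E1 /H2 E2] /=.
  rewrite E2; case: ifP => [/mapP[] //|_]; rewrite -map_comp -E1; congr steps.
  by rewrite -[RHS]map_id; exact: eq_map.
- case: v H => [|n v] H; first by inversion H.
  elim: n y H => [|n IH] y.
    by move=> /eval_Prec0P /IHf[t0 H0]; exists t0 => t /H0 /=.
  move=> /eval_PrecSP[r /IH[t1 H1] /IHg[t2 H2]].
  exists (maxn t1 t2) => t; rewrite geq_max => /andP[/H1 /= E1 /H2 E2].
  by rewrite E1.
- have [/IHf[t1 H1]] := eval_MuP H; rename y into n => Hn.
  have [t2 H2] : exists t0, forall t, t0 <= t -> forall m, m < n -> 1 < steps t f (m :: v).
    elim: n Hn {H H1} => [|n IH] Hn; first by exists 0.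
    have [t2 H2] := IH (fun m mn => Hn m (ltnW mn)).
    have [k /IHf[t3 H3]] := Hn n (ltnSn n).
    exists (maxn t2 t3) => t; rewrite geq_max => /andP[/H2 E2 /H3 E3] m.
    by rewrite ltnS leq_eqVlt => /orP[/eqP ->|/E2 //]; rewrite E3.
  exists (maxn n.+1 (maxn t1 t2)) => t; rewrite !geq_max => /and3P[nt /H1 E1 /H2 E2] /=.
  apply: (@sum_at_most_one t _ _ succn nt) => i _; apply/idP/eqP => [|->].
    case/andP => /eqP fi /bexP ni; apply/eqP; rewrite eqn_leq.
    rewrite leqNgt [X in _ && X]leqNgt; apply/andP; split; apply/negP => im.
      by apply: ni; exists n => //; rewrite E1.
    by have := E2 _ im; rewrite fi.
  by rewrite E1 eqxx; apply/bexP => -[j /E2]; rewrite ltnNge => /negbTE ->.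
Qed.

(** Both outputs are read off [steps] at a common cut-off, so determinism follows from [steps] being
    a function. *)
Lemma eval_fun e v y z : eval e v y -> eval e v z -> y = z.
Proof.
move=> /eval_steps[t1 H1] /eval_steps[t2 H2].
have := H1 _ (leq_maxl t1 t2); rewrite H2 ?leq_maxr //.
by case.
Qed.

Lemma recfun_mem0 n (fs : seq (seq nat -> nat)) :
  (forall f, List.In f fs -> recfun n f) -> recpred n (fun v => 0 \in [seq f v | f <- fs]).
Proof.
elim: fs => [|f fs IH] H /=; first exact: (recfun_const n 0).
have /recpred_neg Hfs := IH (fun g gin => H g (or_intror gin)).
have Hf := H f (or_introl erefl).
have := recpred_neg (recpred_and (recpred_neg (recpred_eq (recfun_const n 0) Hf)) Hfs).
by apply: recpred_ext => v _ /=; rewrite inE negb_and !negbK.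
Qed.

(** The code [e] is fixed: the induction on [e] assembles a total code that simulates it, with the
    cut-off as first argument. *)
Lemma recfun_steps e n : recfun n.+1 (fun w => steps (nth 0 w 0) e (behead w)).
Proof.
elim/rcode_nested_ind: e n => [||i|f gs IHf IHgs|f g IHf IHg|f IHf] n.
- exact: recfun_const.
- apply: recfun_succ; apply: recfun_succ.
  by apply: (@recfun_ext _ (fun w => nth 0 w 1)) (recfun_nth _ _) => -[|x []].
- by apply: recfun_succ; recfun_proj.
- set hs := [seq (fun w => steps (nth 0 w 0) g (behead w)) | g <- gs].
  have Hhs : forall h, List.In h hs -> recfun n.+1 h.
    by rewrite /hs; elim: IHgs => //= g gs' IHg _ IH h [<-|/IH //].
  have := recfun_if (recfun_mem0 Hhs) (recfun_const _ 0) (@recfun_subst n.+1 (size gs).+1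
    (fun w => nth 0 w 0 :: [seq k.-1 | k <- [seq h w | h <- hs]]) _ (IHf _) _ _).
  move=> H; apply: recfun_ext (H _ _).
  + by move=> w sw; rewrite /= /hs -map_comp.
  + by move=> w sw; rewrite /= !size_map.
  + move=> [|i] /=; first exact: recfun_nth.
    elim: hs Hhs i {H} => [|h hs IH] Hhs [|i] /=; do ?exact: recfun_const.
      by apply: recfun_pred; apply: Hhs; left.
    by apply: IH => k kin; apply: Hhs; right.
- case: n => [|n].
    (* On the empty argument list [steps] of a [CPrec] is 0. *)
    by apply: recfun_ext (recfun_const 1 0) => -[|x []].
  have := @recfun_rec n.+2 (fun w => nth 0 w 1)
     (fun w => steps (nth 0 w 0) f (behead (behead w)))
     (fun i r w => if r == 0 then 0 else
         steps (nth 0 w 0) g [:: i, r.-1 & behead (behead w)]) (recfun_nth _ _).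
  move=> H; apply: recfun_ext (H _ _); first by move=> [|t [|x v]].
    apply: (@recfun_subst n.+2 n.+1 (fun w => nth 0 w 0 :: behead (behead w)) _ (IHf n)).
      by move=> [|x [|y v]] //= [->].
    by move=> [|i] /=; [exact: recfun_nth | recfun_proj].
  apply: recfun_if; first by apply: recpred_eq; [exact: recfun_nth | exact: recfun_const].
    exact: recfun_const.
  apply: (@recfun_subst n.+4 n.+3 (fun w => [:: nth 0 (behead (behead w)) 0, nth 0 w 0,
     (nth 0 w 1).-1 & behead (behead (behead (behead w)))]) _ (IHg n.+2)).
    by move=> [|a [|b [|c [|d v]]]] //= [->].
  move=> [|[|[|i]]] /=; do ?[recfun_proj].
  by apply: recfun_pred; exact: recfun_nth.
- apply: (@recfun_sum n.+1 _ (fun m w => if (steps (nth 0 w 0) f (m :: behead w) == 1) &&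
      ~~ bex m (fun i => steps (nth 0 w 0) f (i :: behead w) <= 1) then m.+1 else 0)).
    exact: recfun_nth.
  apply: recfun_if; last exact: recfun_const; last by apply: recfun_succ; exact: recfun_nth.
  apply: recpred_and.
    apply: recpred_eq; last exact: recfun_const.
    apply: (@recfun_subst n.+2 n.+2 (fun w => [:: nth 0 (behead w) 0, nth 0 w 0 &
         behead (behead w)]) _ (IHf _)).
      by move=> [|a [|b v]] //= [->].
    by move=> [|[|i]] /=; recfun_proj.
  apply: recpred_neg; apply: (@recpred_bex n.+2 _
      (fun i w => steps (nth 0 (behead w) 0) f (i :: behead (behead w)) <= 1)).
    exact: recfun_nth.
  apply: recpred_leq; last exact: recfun_const.
  apply: (@recfun_subst n.+3 n.+2 (fun w => [:: nth 0 (behead (behead w)) 0, nth 0 w 0 &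
         behead (behead (behead w))]) _ (IHf _)).
    by move=> [|a [|b [|c v]]] //= [->].
  by move=> [|[|i]] /=; recfun_proj.
Qed.

(** * Strings as binary numbers *)

(** Strings are handled through [(enc s).+1], whose binary expansion is [1s]: its logarithm is the
    length of [s], and halving it drops the last bit. *)
Lemma encS (s : seq bool) :
  (enc s).+1 = foldl (fun n (b : bool) => n.*2 + b) 1 s.
Proof.
rewrite /enc prednK //.
by elim/last_ind: s => // s b IH; rewrite foldl_rcons; lia.
Qed.

Lemma encS_rcons s b : (enc (rcons s b)).+1 = (enc s).+1.*2 + b.
Proof. by rewrite !encS foldl_rcons. Qed.

Lemma encS_bounds s : 2 ^ size s <= (enc s).+1 < 2 ^ (size s).+1.
Proof.
elim/last_ind: s => [|s b]; first by rewrite encS.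
rewrite encS_rcons size_rcons !expnS; case: b; lia.
Qed.

Lemma size_encS s : trunc_log 2 (enc s).+1 = size s.
Proof. by apply: trunc_log_eq => //; exact: encS_bounds. Qed.

Lemma encS_inj s t : (enc s).+1 = (enc t).+1 -> s = t.
Proof.
elim/last_ind: s t => [|s b IH] t; case/lastP: t => [|t b'] //.
- move=> E; have := encS_bounds (rcons t b'); rewrite -E size_rcons encS /= !expnS; lia.
- move=> E; have := encS_bounds (rcons s b); rewrite E size_rcons encS /= !expnS; lia.
- rewrite !encS_rcons => E.
  have -> : s = t by apply: IH; move: E; case: b; case: b'; lia.
  have -> // : b = b'; by move: E; case: b; case: b'; lia.
Qed.

Lemma encS_surj b : 0 < b -> exists s, (enc s).+1 = b.
Proof.
elim/ltn_ind: b => b IH b0; have [->|b1] : b = 1 \/ 1 < b by lia.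
  by exists [::]; rewrite encS.
have [s Es] : exists s, (enc s).+1 = b./2 by apply: IH; lia.
by exists (rcons s (odd b)); rewrite encS_rcons Es; lia.
Qed.

Lemma encS_cat s u : (enc (s ++ u)).+1 %/ 2 ^ size u = (enc s).+1.
Proof.
elim/last_ind: u => [|u b IH]; first by rewrite cats0 divn1.
rewrite -rcons_cat encS_rcons size_rcons expnS divnMA -IH; congr divn.
by case: b; lia.
Qed.

(** Dividing by [2 ^ k] deletes the last [k] bits. The bound on [k] is crude: the length of [t] is
    less than its shifted code. *)
Lemma prefix_encS s t :
  prefix s t = bex (enc t).+2 (fun k => (enc t).+1 %/ 2 ^ k == (enc s).+1).
Proof.
apply/idP/bexP => [/prefixP[u ->]|[k _ /eqP E]].
  exists (size u); last by rewrite encS_cat.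
  have /andP[H _] := encS_bounds (s ++ u).
  have := ltn_expl (size (s ++ u)) (isT : 1 < 2); rewrite size_cat in H *; lia.
(* For larger [k] the quotient is 0, which is no shifted code. *)
have kt : k <= size t.
  rewrite leqNgt; apply/negP => kt; move: E; rewrite divn_small //.
  have /andP[_ H] := encS_bounds t; apply: leq_trans H _.
  by rewrite leq_exp2l.
have sd : size (drop (size t - k) t) = k by rewrite size_drop; lia.
suff -> : s = take (size t - k) t by exact: prefix_take.
apply: encS_inj; rewrite -(encS_cat (take (size t - k) t) (drop (size t - k) t)).
by rewrite cat_take_drop sd E.
Qed.

(** The shifted code maps the strings of length [L] injectively into an interval with [2 ^ L]
    elements, hence bijectively. *)
Lemma big_tuple_encS (T : Type) (idx : T) (op : Monoid.com_law idx) L (F : nat -> T) :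
  \big[op/idx]_(t : L.-tuple bool) F (enc t).+1 =
  \big[op/idx]_(2 ^ L <= b < 2 ^ L.+1) F b.
Proof.
rewrite -{1}[2 ^ L]add0n big_addn (_ : 2 ^ L.+1 - 2 ^ L = 2 ^ L); last first.
  by rewrite expnS; lia.
have bd (t : L.-tuple bool) : 2 ^ L <= (enc t).+1 < 2 ^ L.+1.
  by have := encS_bounds t; rewrite size_tuple.
have lt (t : L.-tuple bool) : (enc t).+1 - 2 ^ L < 2 ^ L.
  by have := bd t; rewrite expnS; lia.
pose f (t : L.-tuple bool) := Ordinal (lt t).
have f_inj : injective f.
  move=> t u /(congr1 val) /= E; apply: val_inj; apply: encS_inj.
  by move: (bd t) (bd u) E => /=; lia.
have f_bij : bijective f.
  by apply: inj_card_bij => //; rewrite card_ord card_tuple card_bool.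
rewrite big_mkord (reindex f) /=; last exact: onW_bij.
by apply: eq_bigr => t _; congr F; have := bd t; lia.
Qed.

(** For positive [b], the logarithm counts the [i] with [2 ^ i.+1 <= b], and [b] itself bounds these
    [i]. *)
Lemma recfun_trunc_log2 : recfun1 (trunc_log 2).
Proof.
apply: (@recfun_ext _ (fun v => \sum_(0 <= i < nth 0 v 0) (2 ^ i.+1 <= nth 0 v 0))).
  move=> v _; set b := nth 0 v 0; case: (posnP b) => [->|b0].
    by rewrite big_geq ?trunc_log0.
  transitivity (\sum_(0 <= i < b) (i < trunc_log 2 b)).
    apply: eq_bigr => i _; congr nat_of_bool; apply/idP/idP => [|H].
      by move=> /trunc_log_max; exact.
    apply: leq_trans (trunc_logP (isT : 1 < 2) b0).
    by rewrite leq_exp2l.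
  have Tb : trunc_log 2 b <= b.
    have := trunc_logP (isT : 1 < 2) b0; have := ltn_expl (trunc_log 2 b) (isT : 1 < 2); lia.
  rewrite (big_cat_nat_idem _ (n := trunc_log 2 b)) //=.
  rewrite [X in _ + X]big_nat_cond [X in _ + X]big1 ?addn0.
    by rewrite (eq_big_nat _ _ (F2 := fun=> 1)) ?sum_nat_const_nat ?subn0 ?muln1 // => i /andP[_ ->].
  by move=> i /andP[/andP[H _] _]; rewrite ltnNge H.
apply: recfun_sum; first exact: recfun_nth.
by apply: recpred_leq; [apply: recfun_exp2; apply: recfun_succ; recfun_proj | recfun_proj].
Qed.

(** * Ranking the elements of a decidable set *)

Lemma sum_pred_lt (P : nat -> bool) a x y : a <= x < y -> P x ->
  \sum_(a <= z < x) P z < \sum_(a <= z < y) P z.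
Proof.
move=> /andP[ax xy] Px; rewrite (@big_cat_nat _ _ _ x.+1 a y) //=; last exact: leqW.
by rewrite big_nat_recr //= Px; lia.
Qed.

Lemma sum_pred_inj (P : nat -> bool) a x y : a <= x -> a <= y -> P x -> P y ->
  \sum_(a <= z < x) P z = \sum_(a <= z < y) P z -> x = y.
Proof.
move=> ax ay Px Py E; case: (ltngtP x y) => // H.
- by have := @sum_pred_lt P a x y; rewrite ax H E ltnn => /(_ isT Px).
- by have := @sum_pred_lt P a y x; rewrite ay H E ltnn => /(_ isT Py).
Qed.

(** The number of elements below [x] grows by at most one when [x] does, so it passes through every
    value up to the total. *)
Lemma sum_pred_surj (P : nat -> bool) a y i : i < \sum_(a <= z < y) P z ->
  exists x, [/\ a <= x < y, P x & \sum_(a <= z < x) P z = i].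
Proof.
elim: y => [|y IH]; first by rewrite big_geq.
case: (leqP a y) => [ay|ay]; last by rewrite big_geq.
rewrite big_nat_recr //=; case: (ltnP i (\sum_(a <= z < y) P z)) => [/IH[x [H1 H2 H3]] _|H1 H2].
  by exists x; split=> //; lia.
exists y; rewrite ay ltnSn; move: H1 H2; case: (P y) => /= H1 H2; split => //; lia.
Qed.

(** * Extensions of a finite set of strings *)

Definition extends (S : seq (seq bool)) (b : nat) : bool :=
  has (fun s => bex b.+1 (fun k => b %/ 2 ^ k == (enc s).+1)) S.

Definition ext_count S L := \sum_(2 ^ L <= b < 2 ^ L.+1) extends S b.

Lemma extends_encS S t : extends S (enc t).+1 = has (fun s => prefix s t) S.
Proof. by apply: eq_has => s; rewrite prefix_encS. Qed.

(** Such a [b] has more than [L] bits after its leading 1, so it equals no code from [S]; dropping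
    its last bit merely lowers the exponent [k] by one. *)
Lemma extends_half (S : seq (seq bool)) L b : (forall s, s \in S -> size s <= L) ->
  2 ^ L.+1 <= b -> extends S b = extends S b./2.
Proof.
move=> HS Lb; have b0 : 0 < b./2 by move: (expn_gt0 2 L) Lb; rewrite expnS; lia.
apply: eq_in_has => s sS; apply/bexP/bexP => -[k kb /eqP E].
  case: k kb E => [|k] kb E; last first.
    move: E; rewrite expnS divnMA divn2 => E; exists k; last by rewrite E.
    have : 0 < b./2 %/ 2 ^ k by rewrite E.
    by rewrite divn_gt0 ?expn_gt0 //; have := ltn_expl k (isT : 1 < 2); lia.
  move: E; rewrite divn1 => E; have /andP[_] := encS_bounds s.
  rewrite -E => H; have := HS s sS => H'.
  have : 2 ^ (size s).+1 <= 2 ^ L.+1 by rewrite leq_exp2l.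
  by move=> /leq_trans /(_ Lb) /(leq_trans H); rewrite ltnn.
by exists k.+1; [lia | rewrite expnS divnMA divn2 E].
Qed.

Lemma ext_countS (S : seq (seq bool)) L : (forall s, s \in S -> size s <= L) ->
  ext_count S L.+1 = 2 * ext_count S L.
Proof.
move=> HS; rewrite /ext_count !expnS.
have D a n : \sum_(2 * a <= b < 2 * (a + n)) extends S b =
             \sum_(a <= b < a + n) (extends S b.*2 + extends S b.*2.+1).
  elim: n => [|n IH]; first by rewrite addn0 !big_geq.
  rewrite !addnS mulnS add2n !big_nat_recr //= ?IH; try lia.
  by rewrite -addnA mul2n.
have {2 3}-> : 2 * 2 ^ L = 2 ^ L + 2 ^ L by lia.
rewrite D big_distrr /=; apply: eq_big_nat => b /andP[lb _].
have lb2 : 2 ^ L.+1 <= b.*2 by rewrite expnS; lia.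
rewrite (extends_half HS lb2) (extends_half HS (leqW lb2)) doubleK.
by rewrite (_ : b.*2.+1./2 = b) ?mul2n ?addnn //; lia.
Qed.

(** From the maximal length in [S] onwards, each further level doubles both the count and the
    denominator. *)
Lemma mu_clopenE (R : realType) (S : seq (seq bool)) L : (forall s, s \in S -> size s <= L) ->
  mu_clopen R S = ((ext_count S L)%:R / 2%:R ^+ L)%R.
Proof.
move=> HS; rewrite /mu_clopen; set L0 := \max_(s <- S) size s.
have HL0 s : s \in S -> size s <= L0 by move=> sS; apply: leq_bigmax_seq.
have -> : #|[set t : L0.-tuple bool | has (fun s => prefix s t) S]%classic| = ext_count S L0.
  rewrite -sum1_card big_mkcond /=.
  rewrite /ext_count -(@big_tuple_encS _ _ addn _ (fun b => nat_of_bool (extends S b))) /=.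
  apply: eq_bigr => t _; rewrite extends_encS.
  have -> : (t \in [set t : L0.-tuple bool | has (fun s => prefix s t) S]%classic) =
      has (fun s => prefix s t) S by apply/idP/idP => [/set_mem|H] //; exact: mem_set.
  by case: has.
have L0L : L0 <= L by apply/bigmax_leqP_seq => s sS _; exact: HS.
rewrite -(subnKC L0L); elim: (L - L0) => [|n IH]; first by rewrite addn0.
rewrite IH addnS ext_countS; last by move=> s /HL0; lia.
rewrite GRing.natrM GRing.exprS GRing.invfM GRing.mulrACA GRing.mulfV ?GRing.mul1r //.
Qed.

(** * Computable nonnegative reals *)

Import Order.TTheory GRing.Theory Num.Theory numFieldNormedType.Exports.
Local Open Scope classical_set_scope.
Local Open Scope ring_scope.

Lemma recfun_half n f : recfun n f -> recfun n (fun v => (f v)./2).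
Proof.
move=> Hf.
apply: (@recfun_ext _ (fun v => \sum_(0 <= i < f v) (2 * i.+1 <= f v))%N); last first.
  apply: recfun_sum => //; apply: recpred_leq; last exact: recfun_behead.
  by apply: recfun_mul; [exact: recfun_const | apply: recfun_succ; exact: recfun_nth].
move=> v _; set k := f v.
have H N : (\sum_(0 <= i < N) (2 * i.+1 <= k) = minn N k./2)%N.
  elim: N => [|N IH]; first by rewrite big_geq // min0n.
  by rewrite big_nat_recr //= IH; case: (leqP (2 * N.+1) k) => /=; lia.
by rewrite H; lia.
Qed.

Lemma exp2_gt0 (R : realType) n : 0 < (2%:R ^+ n : R).
Proof. by rewrite exprn_gt0. Qed.

(** The odd codes of [zdec] denote negative integers; as [r] is nonnegative, replacing such an
    approximation by 0 only brings it closer. *)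
Lemma computable_real_nat (R : realType) (r : R) : 0 <= r -> computable_real r ->
  exists2 a, recfun1 a & forall n, `|(a n)%:R / 2%:R ^+ n - r| <= (2%:R ^+ n)^-1.
Proof.
move=> r0 [e /choice[k Hk]].
have ck : recfun1 k by exists e => -[|n []] // _; case: (Hk n).
exists (fun n => if ((k n)./2 + (k n)./2 == k n)%N then (k n)./2 else 0%N).
  apply: recfun_if; last exact: recfun_const; last exact: recfun_half.
  by apply: recpred_eq => //; apply: recfun_add; exact: recfun_half.
move=> n; have [_] := Hk n; rewrite /zdec addnn.
have [ok|ok] := boolP (odd (k n)); last first.
  rewrite -[X in _ == X]odd_double_half (negbTE ok) add0n eqxx.
  by rewrite pmulrn.
rewrite ifF; last by apply/negbTE; move: ok; lia.
have : 0 <= ((k n).+1./2%:~R : R) / 2%:R ^+ n.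
  by rewrite divr_ge0 // ?ltW ?exp2_gt0 // ler0z.
rewrite intrN mulNr mul0r sub0r normrN (ger0_norm r0) => H.
by rewrite ler0_norm; lra.
Qed.

(** The approximation of index [n.+1] is rounded to a multiple of [2^-n]. Rounding costs at most
    [2^-n / 2], and the approximation is off by at most as much. *)
Lemma computable_real_dyadic (R : realType) (r : R) a b : recfun1 a -> recfun1 b ->
  (forall n, `|(a n)%:R / 2%:R ^+ b n - r| <= (2%:R ^+ n)^-1) -> computable_real r.
Proof.
move=> ca cb Hab.
pose P q (v : seq nat) := let n := nth 0%N v 0%N in
  (2 * (a n.+1 * 2 ^ n) <= 2 * (q * 2 ^ b n.+1) + 2 ^ b n.+1)%N &&
  (2 * (q * 2 ^ b n.+1) <= 2 * (a n.+1 * 2 ^ n) + 2 ^ b n.+1)%N.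
have cP : recpred 2 (fun w => P (nth 0%N w 0%N) (behead w)).
  have cn : recfun 2 (fun w => nth 0%N (behead w) 0%N) by recfun_proj.
  have can := recfun_c1 ca (recfun_succ cn); have cbn := recfun_exp2 (recfun_c1 cb (recfun_succ cn)).
  have c1 := recfun_mul (recfun_const 2 2) (recfun_mul can (recfun_exp2 cn)).
  have c2 := recfun_mul (recfun_const 2 2) (recfun_mul (recfun_nth 2 0) cbn).
  by apply: recpred_and; apply: recpred_leq => //; apply: recfun_add.
have [|g cg Pg] := recfun_min cP.
  move=> v _; rewrite /P; move: (nth _ _ _) => n.
  set x := (a _ * _)%N; have y0 : (0 < 2 ^ b n.+1)%N by rewrite expn_gt0.
  (* The witness is the integer part of [x / y + 1/2], a nearest integer to [x / y]. *)
  move: (2 ^ _)%N y0 => y y0; exists ((2 * x + y) %/ (2 * y))%N.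
  have := divn_eq (2 * x + y) (2 * y); have := ltn_pmod (2 * x + y) (isT : 0 < 2)%N.
  have : ((2 * x + y) %% (2 * y) < 2 * y)%N by rewrite ltn_mod; lia.
  by move: (_ %/ _)%N (_ %% (2 * y))%N => q s; nia.
(* The code of a natural number [q] under [zdec] is [2 * q]. *)
have [e He] := recfun_mul (recfun_const 1 2) cg.
exists e => n; exists (2 * g [:: n])%N; split; first exact: (He [:: n]).
have /= := Pg [:: n] erefl; rewrite /P /=; move: (g _) => q /andP[H1 H2].
have -> : zdec (2 * q) = q by rewrite /zdec oddM /= mul2n doubleK.
have := Hab n.+1; move: (a n.+1) (b n.+1) H1 H2 => x y H1 H2 H.
have H3 : `|q%:~R / 2%:R ^+ n - x%:R / 2%:R ^+ y : R| <= (2%:R ^+ n)^-1 / 2%:R.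
  have Y0 := exp2_gt0 R y; have N0 := exp2_gt0 R n.
  have : 2 * (x%:R * 2 ^+ n) <= 2 * (q%:R * 2 ^+ y) + 2 ^+ y :> R.
    by rewrite -!natrX -!natrM -natrD ler_nat.
  have : 2 * (q%:R * 2 ^+ y) <= 2 * (x%:R * 2 ^+ n) + 2 ^+ y :> R.
    by rewrite -!natrX -!natrM -natrD ler_nat.
  rewrite -pmulrn ler_norml.
  have -> : q%:R / 2 ^+ n - x%:R / 2 ^+ y = (q%:R * 2 ^+ y - x%:R * 2 ^+ n) / (2 ^+ n * 2 ^+ y) :> R.
    by field; rewrite !gt_eqF.
  have -> : (2 ^+ n)^-1 / 2 = (2 ^+ y / 2) / (2 ^+ n * 2 ^+ y) :> R.
    by field; rewrite !gt_eqF.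
  move: (2 ^+ n) (2 ^+ y) N0 Y0 => N Y N0 Y0 H4 H5.
  rewrite -mulNr !ler_pM2r ?invr_gt0 ?mulr_gt0 //.
  by apply/andP; split; lra.
have : (2 ^+ n.+1)^-1 = (2 ^+ n)^-1 / 2 :> R by rewrite exprS invfM mulrC.
have := ler_distD (x%:R / 2%:R ^+ y) (q%:~R / 2%:R ^+ n) r.
move: H H3; lra.
Qed.

(** * Series of dyadic rationals *)

Definition computable_dyadic (R : realType) (u : nat -> R) : Prop :=
  exists a b, [/\ recfun1 a, recfun1 b & forall m, u m = (a m)%:R / 2%:R ^+ b m].

(** The terms are brought to the common denominator [2 ^ B M], whose exponent is the sum of all the
    exponents and so at least each of them. *)
Lemma computable_dyadic_sum (R : realType) (u : nat -> R) :
  computable_dyadic u -> computable_dyadic (fun M => \sum_(0 <= m < M) u m).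
Proof.
move=> [a [b [ca cb uE]]].
pose B M := (\sum_(0 <= m < M) b m)%N.
have cB : recfun1 B by apply: (@recfun_sum 1 _ (fun m _ => b m)); [exact: recfun_nth | apply: recfun_c1 => //; exact: recfun_nth].
exists (fun M => \sum_(0 <= m < M) a m * 2 ^ (B M - b m))%N, B; split => //.
  apply: (@recfun_sum 1 _ (fun m v => a m * 2 ^ (B (nth 0 v 0) - b m))%N); first exact: recfun_nth.
  apply: recfun_mul; first by apply: recfun_c1 => //; exact: recfun_nth.
  apply: recfun_exp2; apply: recfun_sub; first by apply: recfun_c1 => //; recfun_proj.
  by apply: recfun_c1 => //; exact: recfun_nth.
move=> M; rewrite natr_sum mulr_suml; apply: eq_big_nat => m /andP[_ mM].
have bB : (b m <= B M)%N.
  rewrite /B (@big_cat_nat _ _ _ m 0 M) ?(ltnW mM) //= [X in (_ <= _ + X)%N]big_ltn //.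
  exact: leq_trans (leq_addr _ _) (leq_addl _ _).
rewrite uE natrM natrX -{2}(subnK bB) exprD invfM.
by field; rewrite !gt_eqF ?exp2_gt0.
Qed.

(** The tail of [U] after [M] is at most [2^d (r - W M)]. As [r] is computable, a sufficiently late
    [M] can be found by search, and [U M] then approximates the limit. *)
Lemma computable_sum_dominated (R : realType) (u w : nat -> R) (d : nat) (r : R) :
  computable_dyadic u -> computable_dyadic w ->
  (forall m, 0 <= u m <= 2%:R ^+ d * w m) ->
  (fun N => \sum_(0 <= m < N) w m) @ \oo --> r -> computable_real r ->
  exists2 s : R, computable_real s & (fun N => \sum_(0 <= m < N) u m) @ \oo --> s.
Proof.
move=> cu cw uw cvw cr.
have D0 := exp2_gt0 R d.
have w0 m : 0 <= w m by have /andP[u0 H] := uw m; rewrite -(pmulr_rge0 _ D0); exact: le_trans H.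
set W := (fun N => \sum_(0 <= m < N) w m) in cvw.
set U := (fun N => \sum_(0 <= m < N) u m).
have U_nd : nondecreasing_seq U.
  apply/nondecreasing_seqP => n; rewrite /U big_nat_recr //= lerDl.
  by case/andP: (uw n).
have W_nd : nondecreasing_seq W.
  by apply/nondecreasing_seqP => n; rewrite /W big_nat_recr //= lerDl.
have Wr N : W N <= r.
  rewrite -(cvg_lim _ cvw) //; apply: nondecreasing_cvgn_le => //.
  by apply/cvg_ex; exists r.
have UW M N : (M <= N)%N -> U N - U M <= 2%:R ^+ d * (W N - W M).
  move=> MN; rewrite /U /W !(@big_cat_nat _ _ _ M 0 N) //=.
  rewrite ![_ + \sum_(M <= i < N) _]addrC !addrK mulr_sumr; apply: ler_sum => i _.
  by case/andP: (uw i).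
have U0 : U 0%N = 0 by rewrite /U big_geq.
have W0 : W 0%N = 0 by rewrite /W big_geq.
have r0 : 0 <= r by rewrite -W0.
have Ucv : cvgn U.
  apply: nondecreasing_is_cvgn => //; exists (2%:R ^+ d * r) => _ [N _ <-].
  have := UW 0%N N (leq0n _); rewrite U0 W0 !subr0 => /le_trans; apply.
  by rewrite ler_pM2l.
exists (limn U) => //.
have [A [B [cA cB WE]]] := computable_dyadic_sum cw.
have [A' [B' [cA' cB' UE]]] := computable_dyadic_sum cu.
have [a ca Ha] := computable_real_nat r0 cr.
(* With [j = n + d + 2], the test says [(a j - 2) / 2^j <= W M]. The slack 2 makes the search
   succeed once [W M] is within [2^-j] of [r]; success gives [r - W M <= 4 / 2^j], that is, an error
   of at most [2^-n] after multiplication by [2^d]. *)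
pose P M (v : seq nat) := let j := (nth 0 v 0 + d + 2)%N in
  (a j * 2 ^ B M <= A M * 2 ^ j + 2 * 2 ^ B M)%N.
have PE M n : P M [:: n] = (((a (n + d + 2)%N)%:R - 2%:R) / 2%:R ^+ (n + d + 2) <= W M).
  rewrite /P /= -(ler_nat R) natrD !natrM !natrX /W WE.
  rewrite ler_pdivrMr ?exp2_gt0 // mulrAC ler_pdivlMr ?exp2_gt0 // mulrBl.
  by rewrite lerBlDr.
have cP : recpred 2 (fun w => P (nth 0%N w 0%N) (behead w)).
  have cj : recfun 2 (fun w => nth 0 (behead w) 0 + d + 2)%N.
    by apply: recfun_add; [apply: recfun_add; [recfun_proj | exact: recfun_const] | exact: recfun_const].
  have cBM := recfun_exp2 (recfun_c1 cB (recfun_nth 2 0)).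
  apply: recpred_leq; first exact: (recfun_mul (recfun_c1 ca cj) cBM).
  apply: recfun_add; first exact: (recfun_mul (recfun_c1 cA (recfun_nth 2 0)) (recfun_exp2 cj)).
  exact: (recfun_mul (recfun_const 2 2) cBM).
have [|g cg Pg] := recfun_min cP.
  move=> [|n []] // _; set j := (n + d + 2)%N.
  have J0 : 0 < (2%:R ^+ j : R)^-1 by rewrite invr_gt0 exp2_gt0.
  have /cvgrPdist_le/(_ _ J0)[M _ /(_ M (leqnn M)) /= H] := cvw.
  exists M; rewrite PE -/j mulrBl.
  have := Ha j; move: H; rewrite !ler_norml => /andP[H1 H2] /andP[H3 H4].
  by lra.
apply: (@computable_real_dyadic R _ (fun n => A' (g [:: n])) (fun n => B' (g [:: n]))).
- apply: recfun_c1 cA' _; apply: recfun_ext cg => -[|n []] //.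
- apply: recfun_c1 cB' _; apply: recfun_ext cg => -[|n []] //.
move=> n; rewrite -UE -/U; move: (g [:: n]) (Pg [:: n] erefl) => M; rewrite PE => HM.
have -> : \sum_(0 <= m < M) u m = U M by [].
have H1 : U M <= limn U by apply: nondecreasing_cvgn_le.
have H2 : limn U <= U M + 2%:R ^+ d * (r - W M).
  apply: limr_le => //; exists M => // N /= MN.
  have := UW M N MN; rewrite -lerBlDl => /le_trans; apply.
  by rewrite ler_pM2l // lerB.
have H3 : 2%:R ^+ d * (r - W M) <= (2%:R ^+ n)^-1.
  have := Ha (n + d + 2)%N; rewrite ler_norml => /andP[H4 H5].
  have : r - W M <= 4%:R / 2%:R ^+ (n + d + 2) by move: H4 HM; rewrite mulrBl; lra.
  rewrite -(ler_pM2l D0) => /le_trans; apply.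
  rewrite !exprD le_eqVlt; apply/orP; left; apply/eqP.
  by field; rewrite !gt_eqF ?exp2_gt0.
rewrite ler_norml; apply/andP; split; lra.
Qed.

(** * From machines to tests *)

(* [x m] and [y m] are the [m]-th enumerated input and output, shifted by one
   so that [0] means that nothing is enumerated at [m]. *)
Lemma eval_enumerable e : exists x y : nat -> nat,
  [/\ recfun1 x, recfun1 y,
      forall m, x m <> 0%N -> y m <> 0%N /\ eval e [:: (x m).-1] (y m).-1,
      forall m m', x m = x m' -> x m <> 0%N -> m = m' &
      forall p z, eval e [:: p] z -> exists m, x m = p.+1 /\ y m = z.+1].
Proof.
(* The index [m] stands for a cut-off, its logarithm [t], and an input, its remainder [m - 2^t]; so
   every input below [2^t] is tried with cut-off [t]. *)
pose p m := (m - 2 ^ trunc_log 2 m)%N.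
pose F m := steps (trunc_log 2 m) e [:: p m].
(* Only the first index at which an input is seen to halt counts, which makes the enumeration
   injective. *)
pose good m := (F m != 0%N) && ~~ bex m (fun i => (p i == p m) && (F i != 0%N)).
have clog n f : recfun n f -> recfun n (fun v => trunc_log 2 (f v)) by apply: recfun_c1 recfun_trunc_log2.
have cp : recfun1 p by apply: recfun_sub; [exact: recfun_nth | apply: recfun_exp2; apply: clog; exact: recfun_nth].
have cF : recfun1 F.
  have := @recfun_subst 1 2 (fun v => [:: trunc_log 2 (nth 0 v 0); p (nth 0 v 0)])%N _ (recfun_steps e 1).
  apply=> // -[|[|i]] /=; first exact: (clog _ _ (recfun_nth _ _)); first exact: cp.
  by rewrite nth_nil; exact: recfun_const.
have cgood : recpred 1 (fun v => good (nth 0 v 0)%N).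
  apply: recpred_and; first by apply: recpred_neg; apply: recpred_eq => //; exact: recfun_const.
  apply: recpred_neg; apply: (@recpred_bex 1 _ (fun i v => (p i == p (nth 0 v 0)) && (F i != 0))%N).
    exact: recfun_nth.
  apply: recpred_and.
    by apply: recpred_eq; apply: (recfun_c1 cp); recfun_proj.
  by apply: recpred_neg; apply: recpred_eq; [apply: (recfun_c1 cF); recfun_proj | exact: recfun_const].
have Fev m : F m <> 0%N -> eval e [:: p m] (F m).-1.
  by move=> Fm; apply: (@steps_eval (trunc_log 2 m)); rewrite prednK // lt0n; apply/eqP.
exists (fun m => if good m then (p m).+1 else 0%N), (fun m => if good m then F m else 0%N).
split.
- by apply: recfun_if => //; [apply: recfun_succ | exact: recfun_const].
- by apply: recfun_if => //; exact: recfun_const.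
- move=> m; case: ifP => // /andP[/eqP Fm _] _ /=; split=> //; exact: Fev.
- move=> m m'; case: ifP => // gm; case: ifP => // gm' [E] _.
  case/andP: gm => Fm nm; case/andP: gm' => Fm' nm'.
  case: (ltngtP m m') => // H.
  + by case/negP: nm'; apply/bexP; exists m => //; rewrite E eqxx.
  + by case/negP: nm; apply/bexP; exists m' => //; rewrite E eqxx.
- move=> k z ev; have [t0 Ht] := eval_steps ev.
  have ex : exists m, (p m == k) && (F m != 0%N).
    (* The cut-off [s] is late enough for halting to be seen, and [k < 2 ^ s] makes [k] the
       remainder of [2 ^ s + k]. *)
    pose s := maxn t0 k; exists (2 ^ s + k)%N.
    have ks : (k < 2 ^ s)%N by apply: leq_ltn_trans (ltn_expl s _); rewrite // leq_maxr.
    have ls : trunc_log 2 (2 ^ s + k) = s.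
      by apply: trunc_log_eq => //; rewrite leq_addr expnS mul2n -addnn ltn_add2l.
    have pk : p (2 ^ s + k)%N = k by rewrite /p ls addKn.
    by rewrite pk eqxx /F ls pk Ht ?leq_maxl.
  have [m /andP[/eqP pm Fm] mmin] := ex_minnP ex.
  have gm : good m.
    rewrite /good Fm; apply/bexP => -[i im]; rewrite pm => /mmin.
    by rewrite leqNgt im.
  exists m; rewrite gm pm; split=> //.
  have Fe : eval e [:: k] (F m).-1 by rewrite -pm; apply: Fev; exact/eqP.
  by rewrite (eval_fun ev Fe) prednK // lt0n.
Qed.

(** * The measure of the domain, summed along an enumeration *)

Definition lweight (R : realType) (b : nat) : R := (2%:R ^+ trunc_log 2 b)^-1.

Lemma lweight_gt0 (R : realType) b : 0 < lweight R b.
Proof. by rewrite invr_gt0 exp2_gt0. Qed.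

Lemma in_domE e pi : in_dom e pi <-> exists z, eval e [:: enc pi] z.
Proof.
split=> [[s H]|[z H]]; first by exists (enc s).
have [s [Es]] := @encS_surj z.+1 isT.
by exists s; rewrite /machine_out Es.
Qed.

Lemma dom_sumE (R : realType) e N :
  \sum_(0 <= L < N) dom_weight_len R e L =
  \sum_(1 <= b < 2 ^ N) if `[< exists z, eval e [:: b.-1] z >] then lweight R b else 0.
Proof.
elim: N => [|N IH]; first by rewrite !big_geq.
rewrite big_nat_recr // IH /= [RHS](@big_cat_nat _ _ _ (2 ^ N)) ?expn_gt0 ?leq_exp2l //=.
congr +%R; rewrite -big_tuple_encS /dom_weight_len big_mkcond /=.
apply: eq_bigr => t _; rewrite /lweight size_encS size_tuple.
by congr (if _ then _ else _); apply: asbool_equiv_eq; exact: in_domE.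
Qed.

(** A rearrangement of nonnegative terms. Each partial sum along the enumeration is at most some
    length-ordered one, and each length-ordered one is eventually overtaken by the enumeration. *)
Lemma enumerated_weight (R : realType) e (x : nat -> nat) (r : R) :
  (forall m, x m <> 0%N -> exists z, eval e [:: (x m).-1] z) ->
  (forall m m', x m = x m' -> x m <> 0%N -> m = m') ->
  (forall p z, eval e [:: p] z -> exists m, x m = p.+1) ->
  dom_measure_is e r ->
  (fun N => \sum_(0 <= m < N) if x m == 0%N then 0 else lweight R (x m)) @ \oo --> r.
Proof.
move=> xdom xinj xsurj er.
pose G b : R := if `[< exists z, eval e [:: b.-1] z >] then lweight R b else 0.
have G0 b : 0 <= G b by rewrite /G; case: ifP => // _; rewrite ltW ?lweight_gt0.
pose D B := \sum_(1 <= b < B) G b.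
have Dr : (fun N => D (2 ^ N)%N) @ \oo --> r.
  rewrite (_ : (fun N => D (2 ^ N)%N) = fun N => \sum_(0 <= L < N) dom_weight_len R e L) //.
  by apply: funext => N; rewrite dom_sumE.
have D_nd B B' : (B <= B')%N -> D B <= D B'.
  move=> BB'; case: (leqP 1 B) => [B1|B0]; last by rewrite {1}/D big_geq ?sumr_ge0 //; lia.
  by rewrite /D (@big_cat_nat _ _ _ B 1 B') //= lerDl sumr_ge0.
have D_le B : D B <= r.
  apply: le_trans (D_nd B (2 ^ B)%N _) _; first by rewrite ltnW // ltn_expl.
  rewrite -(cvg_lim _ Dr) //; apply: (@nondecreasing_cvgn_le _ (fun N => D (2 ^ N)%N)).
    by move=> i j ij; apply: D_nd; rewrite leq_exp2l.
  by apply/cvg_ex; exists r.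
set w := fun m => if x m == 0%N then 0 else lweight R (x m).
(* On nonzero [b] this multiplicity is 0 or 1 because the enumeration is injective; it allows
   summation by stages to be exchanged with summation by codes. *)
pose c N b := (\sum_(0 <= m < N) (x m == b))%N.
have w_ind B m : \sum_(1 <= b < B) (x m == b)%:R * lweight R b =
    if (0 < x m < B)%N then lweight R (x m) else 0.
  elim: B => [|B IH]; first by rewrite big_geq // andbF.
  case: B IH => [|B] IH; first by rewrite big_geq //; case: (x m).
  rewrite big_nat_recr //= IH; case: (ltngtP (x m) B.+1) => H; rewrite ?mul0r ?addr0 ?mul1r.
  - by congr (if _ then _ else _); lia.
  - by congr (if _ then _ else _); lia.
  - by rewrite H ?ltnn ?andbF ?add0r ?ltnSn /=.
have swap N B : \sum_(0 <= m < N) (if (0 < x m < B)%N then lweight R (x m) else 0) =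
    \sum_(1 <= b < B) (c N b)%:R * lweight R b.
  rewrite -(eq_bigr _ (fun m _ => w_ind B m)) exchange_big /=.
  by apply: eq_bigr => b _; rewrite /c natr_sum mulr_suml.
have c_le N b : (0 < b)%N -> (c N b)%:R * lweight R b <= G b.
  move=> b0; rewrite /G; case: asboolP => [Db|nDb].
    rewrite -[leRHS]mul1r ler_pM2r ?lweight_gt0 // lern1.
    elim: N => [|N IH]; first by rewrite /c big_geq.
    rewrite /c big_nat_recr //= -/(c N b); case: eqP => [xN|_]; last by rewrite addn0.
    rewrite /c big_nat big1 // => m /= mN; apply/eqP; rewrite eqb0; apply/eqP => xm.
    have : m = N by apply: xinj; rewrite xm // => b0'; rewrite b0' in b0.
    by move=> E; rewrite E ltnn in mN.
  rewrite /c big1 ?mul0r // => m _; apply/eqP; rewrite eqb0; apply/eqP => xm.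
  by apply: nDb; rewrite -xm; apply: xdom; rewrite xm => b0'; rewrite b0' in b0.
have W_le N : \sum_(0 <= m < N) w m <= r.
  (* Large enough to exceed every [x m] with [m < N]. *)
  pose B := (\sum_(0 <= m < N) x m).+1.
  apply: le_trans (D_le B).
  rewrite (_ : \sum_(0 <= m < N) w m =
     \sum_(0 <= m < N) (if (0 < x m < B)%N then lweight R (x m) else 0)).
    rewrite swap /D big_nat [leRHS]big_nat; apply: ler_sum => b /andP[b0 _]; exact: c_le.
  apply: eq_big_nat => m /andP[_ mN]; rewrite /w lt0n; case: eqP => //= _.
  rewrite ifT // /B ltnS (@big_cat_nat _ _ _ m 0 N) ?(ltnW mN) //=.
  by rewrite [X in (_ <= _ + X)%N]big_ltn // addnCA leq_addr.
have w_ge0 m : 0 <= w m by rewrite /w; case: eqP => // _; rewrite ltW // lweight_gt0.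
(* The halting inputs with codes below [B] are finitely many, so all are enumerated by some
   stage. *)
have catch B : exists M0, forall M, (M0 <= M)%N -> D B <= \sum_(0 <= m < M) w m.
  suff [M0 HM0] : exists M0, forall M, (M0 <= M)%N -> forall b, (0 < b < B)%N ->
      G b <= (c M b)%:R * lweight R b.
    exists M0 => M /HM0 H.
    apply: (@le_trans _ _ (\sum_(0 <= m < M) (if (0 < x m < B)%N then lweight R (x m) else 0))).
      by rewrite swap /D big_nat [leRHS]big_nat; apply: ler_sum => b /H.
    apply: ler_sum => m _; rewrite /w lt0n; case: eqP => //= _.
    by case: ifP => // _; rewrite ltW // lweight_gt0.
  elim: B => [|B [M1 HM1]]; first by exists 0%N => M _ b; rewrite ltn0 andbF.
  have [M2 HM2] : exists M2, forall M, (M2 <= M)%N -> (0 < B)%N -> G B <= (c M B)%:R * lweight R B.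
    rewrite /G; case: asboolP => [[z /xsurj[m xm]]|_]; last first.
      by exists 0%N => M _ _; rewrite mulr_ge0 // ltW // lweight_gt0.
    exists m.+1 => M mM B0; rewrite -[leLHS]mul1r ler_pM2r ?lweight_gt0 // ler1n.
    rewrite /c (@big_cat_nat _ _ _ m 0 M) ?(ltnW mM) //= [X in (_ < _ + X)%N]big_ltn //.
    by rewrite xm prednK // eqxx addnCA.
  exists (maxn M1 M2) => M; rewrite geq_max => /andP[M1M M2M] b /andP[b0].
  rewrite ltnS leq_eqVlt => /orP[/eqP bB|bB]; first by rewrite bB in b0 *; exact: HM2.
  by apply: HM1; rewrite // b0.
apply/cvgrPdist_le => eps eps0.
move/cvgrPdist_le: Dr => /(_ _ eps0)[N _ /(_ N (leqnn N)) /= HN].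
have [M0 HM0] := catch (2 ^ N)%N.
exists M0 => // M /= /HM0 HM; have := W_le M.
move: HN HM; rewrite !ler_norml => /andP[_ H1] H2 H3.
by apply/andP; split; lra.
Qed.

Lemma mu_clopen_nil (R : realType) : mu_clopen R [::] = 0.
Proof. by rewrite (@mu_clopenE _ _ 0%N) // /ext_count big1 ?mul0r. Qed.

Lemma mu_clopen1 (R : realType) (s : seq bool) : mu_clopen R [:: s] = (2%:R ^+ size s)^-1.
Proof.
rewrite (@mu_clopenE _ _ (size s)); last by move=> t; rewrite inE => /eqP ->.
rewrite /ext_count -(@big_tuple_encS _ _ addn _ (fun b => nat_of_bool (extends [:: s] b))).
rewrite (eq_bigr (fun t : (size s).-tuple bool => nat_of_bool (prefix s t))); last first.
  by move=> t _; rewrite extends_encS /= orbF.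
rewrite (bigD1 (in_tuple s)) //= prefix_refl big1 ?addn0 ?mul1r // => t ts.
apply/eqP; rewrite eqb0; apply: contra ts.
move=> /prefixP[u E]; apply/eqP/val_inj => /=; rewrite E.
suff /size0nil -> : size u = 0%N by rewrite cats0.
apply/eqP; rewrite -(eqn_add2l (size s)) -size_cat -E size_tuple.
by rewrite addn0.
Qed.

Lemma KC_gt (R : realType) e s n :
  (forall pi, machine_out e pi s -> (n < size pi)%N) -> ((n%:R : R)%:E < KC R e s)%E.
Proof.
move=> H; apply: (@lt_le_trans _ _ ((n.+1%:R : R)%:E)); first by rewrite lte_fin ltr_nat.
apply: le_ereal_inf_tmp => _ [pi /H ns <-].
by rewrite lee_fin ler_nat.
Qed.

Lemma KC_le (R : realType) e s pi : machine_out e pi s -> (KC R e s <= ((size pi)%:R : R)%:E)%E.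
Proof. by move=> H; apply: ereal_inf_lbound; exists pi. Qed.

Lemma schnorr_random_incompressible (R : realType) (X : nat -> bool) e d :
  schnorr_random R X -> cm_machine R e ->
  exists n0, forall n, (n0 <= n)%N -> (((n + d)%:R : R)%:E < KC R e (restr X n))%E.
Proof.
move=> rX [_ [r [er cr]]].
have [x [y [cx cy xdom xinj xsurj]]] := eval_enumerable e.
pose lg := trunc_log 2.
(* The logarithms are the lengths of the input and of the output string. *)
pose keep m := (x m != 0%N) && (lg (x m) <= lg (y m) + d)%N.
have clx : recfun1 (fun m => lg (x m)) by apply: recfun_c1 recfun_trunc_log2 cx.
have cly : recfun1 (fun m => lg (y m)) by apply: recfun_c1 recfun_trunc_log2 cy.
have ckeep : recpred 1 (fun v => keep (nth 0 v 0)%N).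
  apply: recpred_and; first by apply: recpred_neg; apply: recpred_eq => //; exact: recfun_const.
  by apply: recpred_leq => //; apply: recfun_add => //; exact: recfun_const.
(* The strings [s m] are merely chosen; the computability of the test rests on their codes
   [(y m).-1]. *)
have /choice[s Hs] m : exists s, x m <> 0%N -> (enc s).+1 = y m.
  case: (pselect (x m <> 0%N)) => [/xdom[ym _]|nx]; last by exists [::].
  have [|s Es] := @encS_surj (y m); first by rewrite lt0n; exact/eqP.
  by exists s.
pose S m := if keep m then [:: s m] else [::].
have muS m : mu_clopen R (S m) = if keep m then lweight R (y m) else 0.
  rewrite /S; case: ifP => [/andP[/eqP xm _]|_]; last exact: mu_clopen_nil.
  by rewrite mu_clopen1 /lweight -(Hs m xm) size_encS.
have tS : schnorr_test R S.
  split.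
    have cc : recfun 2 (fun v => if nth 0 v 1 == 0 then nat_of_bool (keep (nth 0 v 0))
                             else (y (nth 0 v 0)).-1)%N.
      apply: recfun_if; first by apply: recpred_eq; [exact: recfun_nth | exact: recfun_const].
        exact: (@recfun_c1 2 (fun m => nat_of_bool (keep m)) _ ckeep (recfun_nth 2 0)).
      by apply: recfun_pred; apply: recfun_c1 cy (recfun_nth 2 0).
    have [a Ha] := cc; exists a => m; split=> [|i].
      by have /= := Ha [:: m; 0%N] erefl; rewrite /S; case: (keep m).
    rewrite /S; case: ifP => //= /andP[/eqP xm _]; case: i => // _.
    by have /= := Ha [:: m; 1%N] erefl; rewrite -(Hs m xm).
  have [|||||t ct ht] := @computable_sum_dominated R
      (fun m => if keep m then lweight R (y m) else 0)
      (fun m => if x m == 0%N then 0 else lweight R (x m)) d r.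
  - exists (fun m => nat_of_bool (keep m)), (fun m => lg (y m)); split => // m.
    by case: (keep m); rewrite ?mul0r ?mul1r.
  - exists (fun m => nat_of_bool (x m != 0%N)), (fun m => lg (x m)); split => //.
      by apply: recpred_neg; apply: recpred_eq => //; exact: recfun_const.
    by move=> m; case: eqP; rewrite ?mul0r ?mul1r.
  - move=> m; rewrite /keep; case: eqP => /= _; first by rewrite mulr0 lexx.
    case: ifP => [H|_]; last by rewrite lexx mulr_ge0 // ltW ?exp2_gt0 ?lweight_gt0.
    rewrite ltW ?lweight_gt0 //= /lweight -/lg ler_pdivlMr ?exp2_gt0 //.
    rewrite ler_pdivrMl ?exp2_gt0 // -exprD ler_weXn2l //.
    by rewrite ler1n.
  - apply: (enumerated_weight (e := e)) => //.
    + by move=> m /xdom[_ H]; exists (y m).-1.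
    + by move=> p z /xsurj[m [xm _]]; exists m.
  - by [].
  exists t; split=> //.
  by rewrite (funext (fun N => eq_bigr _ (fun m _ => muS m))).
have [m0 Hm0] := rX S tS.
(* This exceeds the length of every output enumerated before [m0]. A short description of a longer
   prefix thus appears at a stage from [m0] on, where [X] avoids the test. *)
exists (\sum_(0 <= m < m0) lg (y m)).+1%N => n n0; apply: KC_gt => pi out.
rewrite ltnNge; apply/negP => le.
have [m [xm ym]] := xsurj _ _ out.
have km : keep m by rewrite /keep xm ym /lg !size_encS /= size_mkseq.
have sm : s m = restr X n by apply: encS_inj; rewrite Hs // xm.
have [mm0|/Hm0] := ltnP m m0; last first.
  by rewrite /in_clopen /S km /= sm size_mkseq eqxx.
have : (n <= \sum_(0 <= m < m0) lg (y m))%N.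
  rewrite (@big_cat_nat _ _ _ m 0 m0) ?(ltnW mm0) //= [X in (_ <= _ + X)%N]big_ltn //.
  by rewrite ym /lg size_encS size_mkseq addnCA leq_addr.
by rewrite leqNgt n0.
Qed.

(** * From tests to machines *)

(** An unbounded search for the output computes any partial function with decidable graph, and
    diverges where there is no output. *)
Lemma eval_of_graph (Q : nat -> nat -> bool) :
  recpred 2 (fun v => Q (nth 0 v 0) (nth 0 v 1))%N ->
  (forall p y y', Q p y -> Q p y' -> y = y') ->
  exists e, forall p y, eval e [:: p] y <-> Q p y.
Proof.
move=> cQ Quniq.
have [f Hf] := recpred_neg (recfun_c2 (f := fun p y => nat_of_bool (Q p y)) cQ (recfun_nth 2 1) (recfun_nth 2 0)).
have {}Hf y p : eval f [:: y; p] (~~ Q p y) by exact: (Hf [:: y; p]).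
exists (CMu f) => p y; split=> [/eval_MuP[ev _]|Qy].
  by have := eval_fun ev (Hf y p); case: (Q p y).
apply: evMu => [|m my]; first by have := Hf y p; rewrite Qy.
exists 0%N; have := Hf m p; case: (boolP (Q p m)) => // Qm _.
by move: my; rewrite (Quniq _ _ _ Qm Qy) ltnn.
Qed.

Lemma recfun_sum_from n a b F : recfun n a -> recfun n b ->
  recfun n.+1 (fun w => F (nth 0 w 0 + a (behead w)) (behead w))%N ->
  recfun n (fun v => \sum_(a v <= i < b v) F i v)%N.
Proof.
move=> Ha Hb HF; have := recfun_sum (F := fun i v => F (i + a v)%N v) (recfun_sub Hb Ha) HF.
by apply: recfun_ext => v _; rewrite -{3}[a v]add0n big_addn.
Qed.

Local Open Scope nat_scope.

Lemma sum_interval a n k b : a + n + k <= b ->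
  \sum_(a <= z < b) (a + n <= z < a + n + k) = k.
Proof.
move=> H; rewrite (@big_cat_nat _ _ _ (a + n)) /=; try lia.
rewrite (@big_cat_nat _ _ _ (a + n + k) (a + n)) /=; try lia.
rewrite big_nat big1 ?add0n; last by move=> i Hi; apply/eqP; rewrite eqb0; lia.
rewrite [X in _ + X]big_nat [X in _ + X]big1 ?addn0; last first.
  by move=> i Hi; apply/eqP; rewrite eqb0; lia.
rewrite (eq_big_nat _ _ (F2 := fun=> 1)); last by move=> i ->.
by rewrite sum_nat_const_nat muln1; lia.
Qed.

Lemma incr_leq (L : nat -> nat) : (forall m, L m < L m.+1) ->
  {mono L : m n / m <= n}.
Proof.
move=> HL; apply: leq_mono => m n; elim: n => // n IH.
rewrite ltnS leq_eqVlt => /orP[/eqP ->|/IH H]; first exact: HL.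
exact: ltn_trans H (HL n).
Qed.

(* Requests of nondecreasing length are served by consecutive dyadic intervals,
   so no free space has to be managed as in the general Kraft-Chaitin theorem:
   the strings [s] of length [L m] with [A m s] are assigned the codes of length
   [L m + c] with values [N m], [N m + 1], .. *)
Lemma interval_machine (A : nat -> nat -> bool) (L : nat -> nat) (c : nat) :
  recpred 2 (fun v => A (nth 0 v 0) (nth 0 v 1)) -> recfun1 L ->
  (forall m, L m < L m.+1) ->
  let k m := \sum_(2 ^ L m <= b < 2 ^ (L m).+1) A m b in
  (forall m, \sum_(0 <= j < m.+1) k j * 2 ^ (L m - L j) <= 2 ^ (L m + c)) ->
  exists e, [/\ prefix_free_machine e,
    forall m s, size s = L m -> A m (enc s).+1 ->
      exists2 pi, size pi = L m + c & machine_out e pi s,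
    forall (R : realType) m, dom_weight_len R e (L m + c) = ((k m)%:R / 2%:R ^+ (L m + c))%R &
    forall (R : realType) l, (forall m, l <> L m + c) -> dom_weight_len R e l = 0%R].
Proof.
move=> cA cL L_incr k kraft.
have L_mono := incr_leq L_incr.
have L_inj x y : L x = L y -> x = y.
  by move=> E; apply/eqP; rewrite eqn_leq -(L_mono x y) -(L_mono y x) E leqnn.
have mL m : m <= L m by elim: m => // m IH; exact: leq_ltn_trans IH (L_incr m).
pose rank m b := \sum_(2 ^ L m <= z < b) A m z.
(* The number of words of length [L m + c] already covered by codewords of smaller index. *)
pose N m := \sum_(0 <= j < m) k j * 2 ^ (L m - L j).
have N_kraft m : N m + k m <= 2 ^ (L m + c).
  by have := kraft m; rewrite big_nat_recr //= subnn muln1.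
have crank : recfun2 rank.
  apply: (@recfun_sum_from 2 _ _ (fun z v => A (nth 0 v 0) z)); last 1 first.
  - apply: (recfun_c2 (f := fun m z => nat_of_bool (A m z)) cA); first by recfun_proj.
    by apply: recfun_add; [exact: recfun_nth | apply: recfun_exp2; apply: (recfun_c1 cL); recfun_proj].
  - by apply: recfun_exp2; apply: (recfun_c1 cL); exact: recfun_nth.
  - exact: recfun_nth.
have ck : recfun1 k.
  by apply: (recfun_c2 crank (recfun_nth _ _)); apply: recfun_exp2; apply: recfun_succ.
have cN : recfun1 N.
  apply: (@recfun_sum 1 _ (fun j v => k j * 2 ^ (L (nth 0 v 0) - L j))); first exact: recfun_nth.
  apply: recfun_mul; first by apply: (recfun_c1 ck); exact: recfun_nth.
  by apply: recfun_exp2; apply: recfun_sub; apply: (recfun_c1 cL); recfun_proj.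
(* The codeword of a string of index [m] has value [N m] plus its rank; the summand [2 ^ (L m + c)]
   is the leading 1 of its code. The search over [m] may stop at [p] since
   [m <= L m < 2 ^ (L m + c)]. *)
pose Q p y := bex p.+1 (fun m => [&& 2 ^ L m <= y.+1, y.+1 < 2 ^ (L m).+1, A m y.+1 &
  p.+1 == 2 ^ (L m + c) + N m + rank m y.+1]).
have cQ : recpred 2 (fun v => Q (nth 0 v 0) (nth 0 v 1)).
  apply: (@recpred_bex 2 _ (fun m v => [&& 2 ^ L m <= (nth 0 v 1).+1,
    (nth 0 v 1).+1 < 2 ^ (L m).+1, A m (nth 0 v 1).+1 &
    (nth 0 v 0).+1 == 2 ^ (L m + c) + N m + rank m (nth 0 v 1).+1])).
    by apply: recfun_succ; exact: recfun_nth.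
  have cm : recfun 3 (fun w => nth 0 w 0) by exact: recfun_nth.
  have cy : recfun 3 (fun w => (nth 0 (behead w) 1).+1) by apply: recfun_succ; recfun_proj.
  have cLm := recfun_c1 cL cm.
  do 3?[apply: recpred_and].
  - exact: recpred_leq (recfun_exp2 cLm) cy.
  - exact: recpred_leq (recfun_succ cy) (recfun_exp2 (recfun_succ cLm)).
  - exact: (recfun_c2 (f := fun m z => nat_of_bool (A m z)) cA).
  apply: recpred_eq; first by apply: recfun_succ; recfun_proj.
  apply: recfun_add; last exact: recfun_c2.
  apply: recfun_add; last exact: recfun_c1.
  by apply: recfun_exp2; apply: recfun_add => //; exact: recfun_const.
have rank_lt m y : 2 ^ L m <= y < 2 ^ (L m).+1 -> A m y -> rank m y < k m.
  exact: sum_pred_lt.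
(* By the Kraft bound [N m + i] is less than [2 ^ (L m + c)], so the length of a codeword reveals
   its index. *)
have len p m i : i < k m -> p.+1 = 2 ^ (L m + c) + N m + i ->
    trunc_log 2 p.+1 = L m + c.
  move=> ik ->; apply: trunc_log_eq => //; rewrite expnS; have := N_kraft m; lia.
have len_inj p m i m' i' : i < k m -> p.+1 = 2 ^ (L m + c) + N m + i ->
    i' < k m' -> p.+1 = 2 ^ (L m' + c) + N m' + i' -> m = m'.
  move=> ik pE ik' pE'; have := len _ _ _ ik pE; rewrite (len _ _ _ ik' pE').
  by move=> /addIn /esym /L_inj.
have Q_uniq p y y' : Q p y -> Q p y' -> y = y'.
  move=> /bexP[m _ /and4P[l1 u1 A1 /eqP E1]] /bexP[m' _ /and4P[l2 u2 A2 /eqP E2]].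
  have r1 := rank_lt m y.+1; rewrite l1 u1 A1 in r1; have {}r1 := r1 isT isT.
  have r2 := rank_lt m' y'.+1; rewrite l2 u2 A2 in r2; have {}r2 := r2 isT isT.
  have mm' := len_inj _ _ _ _ _ r1 E1 r2 E2; subst m'.
  apply: succn_inj; apply: (@sum_pred_inj (A m) (2 ^ L m)) => //.
  by move: E1 E2; rewrite /rank; lia.
have [e He] := eval_of_graph cQ Q_uniq.
have domE p : (exists y, eval e [:: p] y) <->
    exists m i, i < k m /\ p.+1 = 2 ^ (L m + c) + N m + i.
  split=> [[y /He /bexP[m _ /and4P[l u Ay /eqP E]]]|[m [i [ik E]]]].
    by exists m, (rank m y.+1); split=> //; apply: rank_lt => //; rewrite l.
  have [[|b] [/andP[l u] Ab rb]] := sum_pred_surj ik.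
    by move: l; rewrite leqn0 expn_eq0.
  exists b; apply/He/bexP; exists m; last by rewrite l u Ab E /rank rb eqxx.
  have := mL m; have := ltn_expl (L m + c) (isT : 1 < 2); lia.
have in_domP pi : in_dom e pi <-> exists m i,
    [/\ i < k m, (enc pi).+1 = 2 ^ (L m + c) + N m + i & size pi = L m + c].
  rewrite in_domE domE; split=> -[m [i]] => [[ik E]|[ik E _]]; exists m, i; split=> //.
  by rewrite -size_encS; exact: len E.
have domw (R : realType) l : dom_weight_len R e l =
   ((\sum_(2 ^ l <= b < 2 ^ l.+1) `[< exists y, eval e [:: b.-1] y >])%:R / 2%:R ^+ l)%R.
  rewrite -(@big_tuple_encS _ _ addn _ (fun b => nat_of_bool `[< exists y, eval e [:: b.-1] y >])) /=.
  rewrite natr_sum mulr_suml /dom_weight_len big_mkcond; apply: eq_bigr => t _.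
  rewrite (asbool_equiv_eq (in_domE e t)).
  by case: asboolP; rewrite ?mul1r ?mul0r.
exists e; split.
- move=> pi pi' /in_domP[m [i [ik E sp]]] /in_domP[m' [i' [ik' E' sp']]] /prefixP[u pi'E].
  have su : L m + size u = L m'.
    by apply/eqP; rewrite -(eqn_add2r c) addnAC -sp -size_cat -pi'E sp'.
  have : m <= m' by rewrite -L_mono -su leq_addr.
  rewrite leq_eqVlt => /orP[/eqP mm'|mm'].
    have /size0nil u0 : size u = 0 by move: su; rewrite mm'; lia.
    by rewrite pi'E u0 cats0.
  (* The words of length [L m' + c] covered by indices up to [m] lie below [N m']. Hence cutting [u]
     off a codeword of index [m'] leaves a value of at least [N m + k m], which exceeds
     [N m + i]. *)
  exfalso; have : (N m + k m) * 2 ^ size u <= N m'.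
    rewrite {2}/N (@big_cat_nat _ _ _ m.+1 0 m') //=.
    have -> : (N m + k m) * 2 ^ size u = \sum_(0 <= j < m.+1) k j * 2 ^ (L m' - L j).
      rewrite -[N m + k m](_ : \sum_(0 <= j < m.+1) k j * 2 ^ (L m - L j) = _); last first.
        by rewrite big_nat_recr //= subnn muln1.
      rewrite big_distrl /=; apply: eq_big_nat => j /andP[_ jm].
      rewrite -mulnA -expnD; congr (_ * 2 ^ _).
      by rewrite -su addnBAC // L_mono.
    exact: leq_addr.
  have := encS_cat pi u; rewrite -pi'E E' E => Eq H.
  have : 2 ^ (L m + c) + N m + k m <= 2 ^ (L m + c) + N m + i; last by lia.
  rewrite -Eq leq_divRL ?expn_gt0 // -su -[_ + size u + c]addnAC.
  rewrite -addnA mulnDl -expnD -[leqRHS]addnA leq_add2l.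
  by rewrite (leq_trans H) // leq_addr.
- move=> m s ss As; have sb := encS_bounds s; rewrite ss in sb.
  have r := rank_lt _ _ sb As.
  have [|pi Epi] := @encS_surj (2 ^ (L m + c) + N m + rank m (enc s).+1).
    by rewrite -addnA ltn_addr ?expn_gt0.
  exists pi; first by rewrite -size_encS; exact: len Epi.
  apply/He/bexP; case/andP: sb => l u; exists m; last by rewrite l u As Epi eqxx.
  by have := mL m; have := ltn_expl (L m + c) (isT : 1 < 2); lia.
- move=> R m; rewrite domw; congr (_%:R / _)%R.
  rewrite -[RHS](@sum_interval (2 ^ (L m + c)) (N m) (k m) (2 ^ (L m + c).+1)); last first.
    by have := N_kraft m; rewrite expnS; lia.
  apply: eq_big_nat => -[|b] Hb; first by case/andP: Hb; rewrite leqn0 expn_eq0.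
  congr nat_of_bool; apply/asboolP/idP => [/domE[m' [i [ik E]]]|H].
    have mm' : m = m'.
      by have := len _ _ _ ik E; rewrite (trunc_log_eq _ Hb) // => /addIn /L_inj.
    by subst m'; move: E => /=; lia.
  by apply/domE; exists m, (b.+1 - (2 ^ (L m + c) + N m)); split=> /=; lia.
- move=> R l Hl; rewrite domw big_nat big1 ?mul0r // => -[|b] Hb.
    by case/andP: Hb; rewrite leqn0 expn_eq0.
  case: asboolP => //= /domE[m [i [ik E]]].
  by have := len _ _ _ ik E; rewrite (trunc_log_eq _ Hb) // => /Hl.
Qed.

(** * Effective data of a sequence of clopen sets *)

(** Only the values of [e] on the queried pairs are assumed, since [e] may diverge elsewhere. *)
Lemma recfun_code2 n e f g h : recfun n g -> recfun n h ->
  (forall v, size v = n -> eval e [:: g v; h v] (f v)) -> recfun n f.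
Proof.
move=> [a Ha] [b Hb] He; exists (CComp e [:: a; b]) => v sv.
apply: evComp (He v sv); apply: evsCons; first exact: Ha.
by apply: evsCons; [exact: Hb | exact: evsNil].
Qed.

(* The given code may diverge on indices beyond the size of [S m]; truncating
   the index makes the access to the strings of [S m] total. *)
Lemma computable_clopen_seq_total S : computable_clopen_seq S ->
  exists E : nat -> nat -> nat, [/\ recfun2 E, forall m, E m 0 = size (S m) &
    forall m i, i < size (S m) -> E m i.+1 = enc (nth [::] (S m) i)].
Proof.
move=> [e He].
pose sz m := size (S m).
have csz : recfun1 sz.
  by apply: (recfun_code2 (e := e) (recfun_nth _ 0) (recfun_const _ 0)) => v _; case: (He (nth 0 v 0)).
(* The index [i - (i - sz m)] is the minimum of [i] and [sz m]. *)
pose E m i := nth 0 (sz m :: map enc (S m)) (i - (i - sz m)).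
exists E; split=> [|m|m i Hi]; last 2 first.
- by rewrite /E sub0n.
- rewrite /E (_ : i.+1 - (i.+1 - sz m) = i.+1); last by rewrite /sz; lia.
  by rewrite /= (nth_map [::]).
have cs2 := recfun_c1 csz (recfun_nth 2 0).
apply: (recfun_code2 (e := e) (recfun_nth 2 0) (recfun_sub (recfun_nth 2 1) (recfun_sub (recfun_nth 2 1) cs2))) => v _.
rewrite /E; move: (nth 0 v 0) (nth 0 v 1) => m i.
have [Hm0 Hm] := He m; have : i - (i - sz m) <= sz m by lia.
case: (i - (i - sz m)) => [//|j] Hj.
by rewrite /= (nth_map [::]) //; exact: Hm.
Qed.

Lemma size_le_enc s : size s <= enc s.
Proof.
have /andP[H _] := encS_bounds s; rewrite -ltnS; apply: leq_trans H.
exact: ltn_expl.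
Qed.

(** The equation [b %/ 2 ^ k = a] is expressed as [a * 2 ^ k <= b < a.+1 * 2 ^ k], using only
    operations already known to be computable. *)
Lemma computable_extends S : computable_clopen_seq S ->
  recpred 2 (fun v => extends (S (nth 0 v 0)) (nth 0 v 1)).
Proof.
move=> /computable_clopen_seq_total[E [cE E0 ES]].
apply: (@recpred_ext _ (fun v => bex (E (nth 0 v 0) 0) (fun i => bex (nth 0 v 1).+1 (fun k =>
    ((E (nth 0 v 0) i.+1).+1 * 2 ^ k <= nth 0 v 1) &&
    (nth 0 v 1 < (E (nth 0 v 0) i.+1).+2 * 2 ^ k))))).
  move=> v _; move: (nth 0 v 0) (nth 0 v 1) => m b; rewrite E0.
  have D i k : i < size (S m) -> (b %/ 2 ^ k == (enc (nth [::] (S m) i)).+1) =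
     ((E m i.+1).+1 * 2 ^ k <= b) && (b < (E m i.+1).+2 * 2 ^ k).
    move=> Hi; rewrite ES // -leq_divRL ?expn_gt0 // -ltn_divLR ?expn_gt0 //.
    by rewrite ltnS eqn_leq andbC.
  apply/bexP/(has_nthP [::]) => -[i Hi /bexP[k Hk H]]; exists i => //; apply/bexP; exists k => //.
    by rewrite D.
  by rewrite -D.
apply: (@recpred_bex 2 _ (fun i v => bex (nth 0 v 1).+1 (fun k =>
    ((E (nth 0 v 0) i.+1).+1 * 2 ^ k <= nth 0 v 1) &&
    (nth 0 v 1 < (E (nth 0 v 0) i.+1).+2 * 2 ^ k)))).
  by apply: (recfun_c2 cE); [exact: recfun_nth | exact: recfun_const].
apply: (@recpred_bex 3 _ (fun k w =>
    ((E (nth 0 (behead w) 0) (nth 0 w 0).+1).+1 * 2 ^ k <= nth 0 (behead w) 1) &&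
    (nth 0 (behead w) 1 < (E (nth 0 (behead w) 0) (nth 0 w 0).+1).+2 * 2 ^ k))).
  by apply: recfun_succ; recfun_proj.
have cEi : recfun 4 (fun w => E (nth 0 (behead (behead w)) 0) (nth 0 (behead w) 0).+1).
  by apply: (recfun_c2 cE); [recfun_proj | apply: recfun_succ; recfun_proj].
have ck := recfun_exp2 (recfun_nth 4 0).
have cb : recfun 4 (fun w => nth 0 (behead (behead w)) 1) by recfun_proj.
apply: recpred_and.
  exact: recpred_leq (recfun_mul (recfun_succ cEi) ck) cb.
exact: recpred_leq (recfun_succ cb) (recfun_mul (recfun_succ (recfun_succ cEi)) ck).
Qed.

(** A string is no longer than its code, so the sum of the codes in [S m] bounds the lengths; adding
    1 and accumulating over [m] makes the bound strictly increasing. *)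
Lemma computable_length_bound S : computable_clopen_seq S ->
  exists L, [/\ recfun1 L, forall m, L m < L m.+1 &
                forall m s, s \in S m -> size s <= L m].
Proof.
move=> /computable_clopen_seq_total[E [cE E0 ES]].
pose l m := (\sum_(0 <= i < E m 0) E m i.+1).+1.
have cl : recfun1 l.
  apply: recfun_succ; apply: (@recfun_sum 1 _ (fun i v => E (nth 0 v 0) i.+1)).
    by apply: (recfun_c2 cE); [exact: recfun_nth | exact: recfun_const].
  by apply: (recfun_c2 cE); [recfun_proj | apply: recfun_succ; recfun_proj].
exists (fun m => \sum_(0 <= j < m.+1) l j); split.
- apply: (@recfun_sum 1 _ (fun j v => l j)); first by apply: recfun_succ; exact: recfun_nth.
  by apply: (recfun_c1 cl); exact: recfun_nth.
- by move=> m; rewrite [X in _ < X]big_nat_recr //= /l addnS ltnS leq_addr.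
move=> m s /(nthP [::])[i Hi <-]; rewrite big_nat_recr //=.
apply: leq_trans (leq_addl _ _); apply: leqW; rewrite E0.
apply: leq_trans (size_le_enc _) _; rewrite -ES //.
rewrite (@big_cat_nat _ _ _ i 0 (size (S m))) ?(ltnW Hi) //= [X in _ <= _ + X]big_ltn //.
by rewrite addnCA leq_addr.
Qed.

Lemma incompressible_schnorr_random (R : realType) (X : nat -> bool) :
  (forall e, cm_machine R e -> forall d, exists n0, forall n, n0 <= n ->
     (((n + d)%:R : R)%:E < KC R e (restr X n))%E) ->
  schnorr_random R X.
Proof.
move=> HX S [cS [r [cr Sr]]].
have [L [cL L_incr HL]] := computable_length_bound cS.
have cA := computable_extends cS.
pose k m := ext_count (S m) (L m).
have muE m : mu_clopen R (S m) = ((k m)%:R / 2%:R ^+ L m)%R by apply: mu_clopenE; exact: HL.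
set U := (fun N => _) in Sr.
have U_nd : nondecreasing_seq U.
  apply/nondecreasing_seqP => n; rewrite /U big_nat_recr //= lerDl muE.
  by rewrite divr_ge0 // ltW ?exp2_gt0.
have U_le N : (U N <= r)%R.
  rewrite -(cvg_lim _ Sr) //; apply: nondecreasing_cvgn_le => //.
  by apply/cvg_ex; exists r.
have r0 : (0 <= r)%R by apply: le_trans (U_le 0); rewrite /U big_geq.
have [c rc] : exists c, (r <= 2%:R ^+ c)%R.
  exists (Num.Def.truncn r).+1; apply: le_trans (ltW (truncnS_gt r)) _.
  by rewrite -natrX ler_nat ltnW // ltn_expl.
have L_mono := incr_leq L_incr.
have [|e [pfree out domw domw0]] := @interval_machine (fun m => extends (S m)) L c cA cL L_incr.
  (* The Kraft sum equals [2^(L m) * U m.+1], where [U m.+1 <= r <= 2^c]. *)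
  move=> m; rewrite -(ler_nat R) natr_sum natrX.
  apply: (@le_trans _ _ (U m.+1 * 2%:R ^+ L m)%R); last first.
    by rewrite exprD mulrC ler_pM2l ?exp2_gt0 // (le_trans (U_le _)).
  rewrite /U mulr_suml !big_nat; apply: ler_sum => j /andP[_ jm].
  have jm' : L j <= L m by rewrite L_mono.
  rewrite muE natrM natrX -{2}(subnK jm') exprD -/(k j).
  by rewrite le_eqVlt; apply/orP; left; apply/eqP; field; rewrite gt_eqF ?exp2_gt0.
have C0 := exp2_gt0 R c.
have cm : cm_machine R e.
  split=> //; exists (r / 2%:R ^+ c)%R; split; last first.
    have [a ca Ha] := computable_real_nat r0 cr.
    apply: (computable_real_dyadic (a := a) (b := fun n => n + c)) => //.
      by apply: recfun_add; [exact: recfun_nth | exact: recfun_const].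
    move=> n; rewrite exprD invfM mulrA -mulrBl normrM.
    rewrite (@ger0_norm _ (2%:R ^+ c)^-1%R) ?invr_ge0 ?(ltW C0) // ler_pdivrMr //.
    apply: le_trans (Ha n) _; rewrite ler_peMr ?invr_ge0 ?(ltW (exp2_gt0 R n)) //.
    by rewrite exprn_ege1 // ler1n.
  pose V N := (\sum_(0 <= l < N) dom_weight_len R e l)%R.
  have dw0 l : (0 <= dom_weight_len R e l)%R.
    by apply: sumr_ge0 => t _; rewrite invr_ge0 ltW ?exp2_gt0.
  have V_nd M N : M <= N -> (V M <= V N)%R.
    by move=> MN; rewrite /V (@big_cat_nat _ _ _ M 0 N) //= lerDl sumr_ge0.
  (* The domain words of length less than [L M + c] are exactly those of index below [M], so at
     these cuts the two series agree up to the factor [2^c]. *)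
  have VU M : (V (L M + c) = U M / 2%:R ^+ c)%R.
    elim: M => [|M IH].
      rewrite /U [in RHS]big_geq // mul0r /V big_nat big1 // => l /andP[_ Hl].
      apply: domw0 => m E; move: Hl; rewrite E ltn_add2r.
      by rewrite ltnNge L_mono.
    have lt : L M + c < L M.+1 + c by rewrite ltn_add2r.
    rewrite /V (@big_cat_nat _ _ _ (L M + c) 0) ?(ltnW lt) //= -/(V _) IH.
    rewrite big_ltn // big_nat big1 ?addr0 ?domw; last first.
      move=> l /andP[l1 l2]; apply: domw0 => m E; move: l1 l2.
      by rewrite E !ltn_add2r !ltnNge !L_mono; lia.
    rewrite /U big_nat_recr //= mulrDl muE exprD invfM mulrA.
    by [].
  apply/cvgrPdist_le => eps eps0.
  have eps1 : (0 < eps * 2%:R ^+ c)%R by rewrite mulr_gt0.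
  move/cvgrPdist_le: Sr => /(_ _ eps1)[M _ /(_ M (leqnn M)) /= HM].
  exists (L M + c) => // N /= HN; rewrite -/(V N).
  have H1 := V_nd _ _ HN; rewrite VU in H1.
  (* Moving up to the cut [L N + c] bounds [V N] by [r / 2^c] from above. *)
  have NL : N <= L N + c.
    by apply: leq_trans (leq_addr _ _); elim: N {HN H1} => // N IH; exact: leq_ltn_trans IH _.
  have H2 := V_nd _ _ NL; rewrite VU in H2.
  have H3 : (U N / 2%:R ^+ c <= r / 2%:R ^+ c)%R by rewrite ler_pM2r ?invr_gt0.
  move: HM; rewrite ler_norml => /andP[_]; rewrite -ler_pdivrMr // mulrBl => HM.
  rewrite ler_norml; apply/andP; split; lra.
(* The constant [d] is taken to be [c], the excess of codeword length over string length. *)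
have [n0 Hn0] := HX e cm c.
exists n0 => m nm; apply/negP => XS.
have nL : n0 <= L m.
  by apply: leq_trans nm _; elim: m {XS} => // m IH; exact: leq_ltn_trans IH _.
have := Hn0 _ nL; apply/negP; rewrite -leNgt.
have [||pi spi piout] := out m (restr X (L m)); first exact: size_mkseq.
  rewrite extends_encS; move: XS => /hasP[s sS /eqP Es]; apply/hasP; exists s => //.
  apply/prefixP; exists (drop (size s) (restr X (L m))).
  rewrite -{1}(cat_take_drop (size s) (restr X (L m))); congr cat.
  rewrite Es size_mkseq /restr /mkseq -map_take take_iota.
  by congr map; congr iota; apply/minn_idPl; exact: HL.
by rewrite -spi; exact: KC_le.
Qed.

Local Close Scope nat_scope.
Local Close Scope ring_scope.
Local Close Scope classical_set_scope.

Theorem mainTheorem17 (R : realType) (X : nat -> bool) :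
  schnorr_random R X <->
  (forall e : rcode, cm_machine R e ->
     forall d : nat, exists n0 : nat, forall n : nat, (n0 <= n)%N ->
       ((((n + d)%:R : R)%:E) < KC R e (restr X n))%E).
Proof.
split=> [rX e cm d|]; first exact: schnorr_random_incompressible.
exact: incompressible_schnorr_random.
Qed.
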